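(* Let $(u_l,u_r,\sigma)$ be a 2-contact discontinuity of the full Euler system for a perfect gas described below. If $e_l>e_r$, then for every $a\in(0,e_r/e_l)\cup(1,\infty)$, $(u_l,u_r,\sigma)$ does not satisfy $a$-contraction. If $e_l<e_r$, then for every $a\in(0,1)\cup(e_r/e_l,\infty)$, $(u_l,u_r,\sigma)$ does not satisfy $a$-contraction.
   Context: Full Euler system: $\partial_t\rho+\partial_x(\rho v)=0$, $\partial_t(\rho v)+\partial_x(\rho v^2+p)=0$, $\partial_t(\rho(\tfrac12v^2+e))+\partial_x(\rho(\tfrac12v^2+e)v+pv)=0$, with $p=(\gamma-1)\rho e$, $\gamma>1$, $\rho>0$, $e>0$. Conservative variables $u=(\rho,q,\mathcal E)$ with $q=\rho v$, $\mathcal E=\rho(\tfrac12v^2+e)$ (so $e=\mathcal E/\rho-q^2/(2\rho^2)$); entropy $\eta(u)=(\gamma-1)\rho\ln\rho-\rho\ln e$, with entropy flux $Q$ satisfying $\nabla Q=\nabla\eta\,\nabla F$ ($F$ the flux). Characteristic speeds $\lambda_1=v-c$, $\lambda_2=v$, $\lambda_3=v+c$, $c=\sqrt{\gamma(\gamma-1)e}$; the second field is linearly degenerate. A 2-contact discontinuity is a Rankine–Hugoniot discontinuity $(u_l,u_r,\sigma)$, $u_l\ne u_r$, of the second family, characterized by $v_l=v_r=\sigma$ and $p_l=p_r$; $e_l,e_r$ denote the internal energies of $u_l,u_r$. Relative entropy $\eta(u|w)=\eta(u)-\eta(w)-\nabla\eta(w)\cdot(u-w)$. a-contraction: with $E_a(u(t),h)=\int_{-\infty}^h\eta(u(t,x)|u_l)dx+a\int_h^\infty\eta(u(t,x)|u_r)dx$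 and $S(x)=u_l$ ($x<0$), $u_r$ ($x>0$), the discontinuity satisfies $a$-contraction if for every bounded convex set $\mathcal U_K$ of states there is $C_K$ such that for every entropy weak solution $u\in\mathcal U_K\cap BV_{loc}((0,T)\times\mathbb R)^3$ (weak solution with $\partial_t\eta(u)+\partial_xQ(u)\le0$) with initial datum $u_0$, $E_a(u_0,0)<\infty$, there is a Lipschitz $h$, $h(0)=0$, with $E_a(u(t),h(t))\le E_a(u(s),h(s))$ for a.e. $t>s>0$, $|h'(t)|\le C_K$, $|h(t)-\sigma t|\le C_K\sqrt t\|u_0-S\|_{L^2}$. *)

(* Defs.v *)
From mathcomp Require Import all_boot all_order all_algebra.
From mathcomp Require Import all_classical all_reals all_analysis.
Import Order.TTheory GRing.Theory Num.Theory numFieldNormedType.Exports.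
Set Implicit Arguments. Unset Strict Implicit. Unset Printing Implicit Defensive.
Local Open Scope classical_set_scope.
Local Open Scope ring_scope.

Section Euler.
Variable R : realType.

(* conservative variables u = (rho, q, Eng) with q = rho v, Eng = rho (v^2/2 + e) *)
Definition state := (R * R * R)%type.
Definition rho (u : state) : R := u.1.1.
Definition mom (u : state) : R := u.1.2.
Definition energy (u : state) : R := u.2.

Definition mkstate (r q E : R) : state := (r, q, E).
Definition sadd (u w : state) : state :=
  mkstate (rho u + rho w) (mom u + mom w) (energy u + energy w).
Definition sscale (s : R) (u : state) : state :=
  mkstate (s * rho u) (s * mom u) (s * energy u).
Definition ssub (u w : state) : state := sadd u (sscale (-1) w).
Definition snorm (u : state) : R :=
  Num.sqrt (rho u ^+ 2 + mom u ^+ 2 + energy u ^+ 2).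

Definition vel (u : state) : R := mom u / rho u.
Definition eint (u : state) : R :=
  energy u / rho u - mom u ^+ 2 / (2 * rho u ^+ 2).
Definition pres (gamma : R) (u : state) : R := (gamma - 1) * rho u * eint u.
Definition admissible (u : state) : Prop := 0 < rho u /\ 0 < eint u.

Definition flux (gamma : R) (u : state) : state :=
  mkstate (mom u) (mom u * vel u + pres gamma u)
          (energy u * vel u + pres gamma u * vel u).

Definition entropy (gamma : R) (u : state) : R :=
  (gamma - 1) * rho u * ln (rho u) - rho u * ln (eint u).

(* entropy flux Q = eta * v (it satisfies grad Q = grad eta . grad F) *)
Definition entropy_flux (gamma : R) (u : state) : R := entropy gamma u * vel u.

(* relative entropy eta(u|w) = eta(u) - eta(w) - grad eta(w).(u - w),
   the last term written as a directional derivative *)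
Definition rel_entropy (gamma : R) (u w : state) : R :=
  entropy gamma u - entropy gamma w
  - derive1 (fun s : R => entropy gamma (sadd w (sscale s (ssub u w)))) 0.

Definition contact2 (gamma : R) (ul ur : state) (sigma : R) : Prop :=
  [/\ admissible ul, admissible ur, ul <> ur,
      vel ul = sigma /\ vel ur = sigma & pres gamma ul = pres gamma ur].

Definition bounded_convex_states (UK : set state) : Prop :=
  [/\ (forall w, UK w -> admissible w),
      (exists M : R, forall w, UK w ->
          `|rho w| <= M /\ `|mom w| <= M /\ `|energy w| <= M) &
      (forall w1 w2 (l : R), UK w1 -> UK w2 -> 0 <= l <= 1 ->
          UK (sadd (sscale l w1) (sscale (1 - l) w2)))].

Definition dt (phi : R -> R -> R) (t x : R) : R := derive1 (fun s => phi s x) t.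
Definition dx (phi : R -> R -> R) (t x : R) : R := derive1 (fun y => phi t y) x.

Definition C1_2 (phi : R -> R -> R) : Prop :=
  [/\ (forall t x, derivable (fun s => phi s x) t 1 /\
                   derivable (fun y => phi t y) x 1),
      continuous (fun p : R * R => phi p.1 p.2),
      continuous (fun p : R * R => dt phi p.1 p.2) &
      continuous (fun p : R * R => dx phi p.1 p.2)].

Definition supp_in (phi : R -> R -> R) (a b c d : R) : Prop :=
  forall t x, ~ (a <= t <= b /\ c <= x <= d) -> phi t x = 0.

Let mu := @lebesgue_measure R.

Definition strip (T : R) : set (R * R) := [set p | 0 < p.1 < T].

Definition meas2 (f : R -> R -> R) : Prop :=
  measurable_fun [set: R * R] (fun p : R * R => f p.1 p.2).

(* f in BV_loc((0,T) x R): finite total variation on every rectangle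
   compactly contained in (0,T) x R *)
Definition BVloc (T : R) (f : R -> R -> R) : Prop :=
  forall a b c d : R, 0 < a -> a < b -> b < T -> c < d ->
  exists M : R, forall psi1 psi2 : R -> R -> R,
    C1_2 psi1 -> C1_2 psi2 -> supp_in psi1 a b c d -> supp_in psi2 a b c d ->
    (forall t x, psi1 t x ^+ 2 + psi2 t x ^+ 2 <= 1) ->
    (\int[(mu \x mu)%E]_(p in [set p : R * R | (a < p.1 < b)%R /\ (c < p.2 < d)%R])
        (f p.1 p.2 * (dt psi1 p.1 p.2 + dx psi2 p.1 p.2))%:E <= M%:E)%E.

(* weak formulation for one scalar equation  d_t w + d_x g = 0, with
   initial datum w0, tested against C^1 functions compactly supported in
   [0,T) x R *)
Definition weak_eq (T : R) (w g : R -> R -> R) (w0 : R -> R) : Prop :=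
  forall (phi : R -> R -> R) (a b c d : R), C1_2 phi -> b < T ->
    supp_in phi a b c d ->
    ((\int[(mu \x mu)%E]_(p in strip T)
        (w p.1 p.2 * dt phi p.1 p.2 + g p.1 p.2 * dx phi p.1 p.2)%:E)
     + (\int[mu]_x (w0 x * phi 0 x)%:E) = 0)%E.

(* entropy inequality  d_t eta(u) + d_x Q(u) <= 0  in D'((0,T) x R) *)
Definition entropy_ineq (gamma T : R) (u : R -> R -> state) : Prop :=
  forall (phi : R -> R -> R) (a b c d : R), C1_2 phi -> 0 < a -> b < T ->
    supp_in phi a b c d -> (forall t x, 0 <= phi t x) ->
    (0 <= \int[(mu \x mu)%E]_(p in strip T)
        (entropy gamma (u p.1 p.2) * dt phi p.1 p.2
         + entropy_flux gamma (u p.1 p.2) * dx phi p.1 p.2)%:E)%E.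

Definition entropy_weak_solution (gamma T : R) (u : R -> R -> state)
    (u0 : R -> state) : Prop :=
  [/\ [/\ meas2 (fun t x => rho (u t x)), meas2 (fun t x => mom (u t x)) &
          meas2 (fun t x => energy (u t x))],
      [/\ measurable_fun (@setT R) (fun x => rho (u0 x)),
          measurable_fun (@setT R) (fun x => mom (u0 x)) &
          measurable_fun (@setT R) (fun x => energy (u0 x))],
      [/\ weak_eq T (fun t x => rho (u t x)) (fun t x => rho (flux gamma (u t x)))
            (fun x => rho (u0 x)),
          weak_eq T (fun t x => mom (u t x)) (fun t x => mom (flux gamma (u t x)))
            (fun x => mom (u0 x)) &
          weak_eq T (fun t x => energy (u t x))
            (fun t x => energy (flux gamma (u t x))) (fun x => energy (u0 x))] &
      entropy_ineq gamma T u].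

Definition Ea (gamma a : R) (ul ur : state) (v : R -> state) (h : R) : \bar R :=
  (\int[mu]_(x in [set x : R | (x < h)%R]) (rel_entropy gamma (v x) ul)%:E
   + a%:E * \int[mu]_(x in [set x : R | (h < x)%R]) (rel_entropy gamma (v x) ur)%:E)%E.

Definition Sdisc (ul ur : state) (x : R) : state := if x < 0 then ul else ur.

Definition L2dist (u0 : R -> state) (ul ur : state) : \bar R :=
  Lnorm mu 2%:E (fun x => (snorm (ssub (u0 x) (Sdisc ul ur x)))%:E).

Definition a_contraction (gamma a : R) (ul ur : state) (sigma : R) : Prop :=
  forall UK : set state, bounded_convex_states UK ->
  exists CK : R, forall (T : R) (u : R -> R -> state) (u0 : R -> state),
    0 < T ->
    (forall t x, 0 < t < T -> UK (u t x)) ->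
    (forall x, UK (u0 x)) ->
    BVloc T (fun t x => rho (u t x)) -> BVloc T (fun t x => mom (u t x)) ->
    BVloc T (fun t x => energy (u t x)) ->
    entropy_weak_solution gamma T u u0 ->
    (Ea gamma a ul ur u0 0 < +oo)%E ->
    exists h : R -> R,
      [/\ h 0 = 0,
          (exists L : R, forall s t, 0 <= s < T -> 0 <= t < T ->
              `|h t - h s| <= L * `|t - s|),
          (exists N : set R, mu.-negligible N /\
             forall s t, 0 < s -> s < t -> t < T -> ~ N s -> ~ N t ->
               (Ea gamma a ul ur (u t) (h t) <= Ea gamma a ul ur (u s) (h s))%E),
          (exists N : set R, mu.-negligible N /\
             forall t, 0 < t < T -> ~ N t ->
               derivable h t 1 /\ `|derive1 h t| <= CK) &
          (forall t, 0 < t < T ->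
             ((`|h t - sigma * t|)%:E
               <= (CK * Num.sqrt t)%:E * L2dist u0 ul ur)%E)].

End Euler.

(* Main.v *)
Require Import Defs.
From HB Require Import structures.
From mathcomp Require Import all_boot all_order all_algebra.
From mathcomp Require Import all_classical all_reals all_analysis measurable_realfun.
From mathcomp Require Import ring lra.
Import Order.TTheory GRing.Theory Num.Theory numFieldNormedType.Exports.
Set Implicit Arguments. Unset Strict Implicit. Unset Printing Implicit Defensive.
Local Open Scope classical_set_scope.
Local Open Scope ring_scope.

(** For [a <> e_r / e_l] we exhibit an entropy solution along which [E_a] strictly increases, whatever the
    shift.  Take a base state [b] with the velocity and the pressure of the contact, and an isentropic simple
    wave which goes from [b] to a plateau state [w] and back to [b]: one branch is a rarefaction centred in the
    past, the other a compression centred in the future, so the solution stays Lipschitz for a short time.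
    Contacts join [b] to [u_l] on the far left and to [u_r] on the far right.  No entropy is dissipated, so
    while the shift [h] stays in the plateau,
      [E_a(u(t), h) = E_a(u(0), 0) + h (eta(w|u_l) - a eta(w|u_r)) + t D],
    and if [eta(w|u_l) = a eta(w|u_r)] then [D = (v_w - sigma) (p_w - p) (a / e_r - 1 / e_l)].
    Along the wave curve through [u_l] (if [a < e_r / e_l]) or [u_r] (if [a > e_r / e_l]) the difference
    [eta(w|u_l) - a eta(w|u_r)] takes opposite signs at [b] and near vacuum, hence vanishes at some [w]; the
    family of the wave is chosen so that [D > 0].

    Such a solution is a superposition of travelling steps: every conserved quantity [f(u)] and its flux are
    [f(u(t,x)) = c + int m(z) 1{y(z) + l(z) t <= x} dz] and [c' + int l(z) m(z) 1{y(z) + l(z) t <= x} dz].  By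
    Fubini the weak equations, the BV bound and the balance laws reduce to those of one travelling step. *)

(** * Integrals *)

(** The shift is arbitrary, so one solution has to defeat all of them. A Lipschitz [h] with
    [h 0 = 0], however fast, stays in the plateau for a short time, and there the equality
    [eta(w|u_l) = a eta(w|u_r)] makes [E_a] independent of the position of [h]. The threshold
    [e_r / e_l] comes from vacuum: there [eta(w|u_l)] and [eta(w|u_r)] tend to [(gamma - 1) rho_l]
    and [(gamma - 1) rho_r], so the gap tends to [p (1 / e_l - a / e_r)]. It is
    [- a eta(u_l|u_r) < 0] at [u_l] and [eta(u_r|u_l) > 0] at [u_r], so the sign of [a - e_r / e_l]
    decides which of the two serves as base state; the contact on that side then has no jump.
    Parametrised by the sound speed, a simple wave has an affine characteristic speed. With affine
    initial positions the whole fan is then inverted by one division. The superposition into steps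
    avoids integrating by parts over regions with moving boundaries: the only integrations by parts
    left are along a characteristic line or along a time slice. *)

Definition bdd {T : Type} {R : realType} (s : T -> R) : Prop := exists M : R, forall x, `|s x| <= M.

(** Real values let [ring] and [lra] act on integrals; the price is that splitting an integral asks
    for integrability. The lock keeps unification from unfolding it. *)
HB.lock Definition rint d (T : measurableType d) (R : realType)
  (m : {measure set T -> \bar R}) (f : T -> R) : R := Rintegral m setT f.

Section integ.
Context d (T : measurableType d) (R : realType) (m : {measure set T -> \bar R}).

Definition integ (f : T -> R) : Prop := m.-integrable setT (EFin \o f).

Lemma rintE f : rint m f = fine (\int[m]_x (f x)%:E)%E.
Proof. by rewrite rint.unlock. Qed.

Lemma rint_EFin f : integ f -> (rint m f)%:E = (\int[m]_x (f x)%:E)%E.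
Proof. by move=> fi; rewrite rint.unlock /Rintegral fineK//; exact: integrable_fin_num. Qed.

Lemma integ_meas f : integ f -> measurable_fun setT f.
Proof. by move=> /measurable_int/measurable_EFinP. Qed.

Lemma bdd_bounded (s : T -> R) : bdd s -> [bounded s x | x in setT].
Proof.
move=> [M sM]; exists M; split; first by rewrite num_real.
by move=> N MN x _; apply: (le_trans (sM x)); exact: ltW.
Qed.

Lemma integD f g : integ f -> integ g -> integ (fun x => f x + g x).
Proof. by move=> fi gi; have := integrableD measurableT fi gi. Qed.

Lemma integZ c f : integ f -> integ (fun x => c * f x).
Proof. by move=> fi; have := integrableZl measurableT c fi. Qed.

Lemma integ_mul f s : integ f -> measurable_fun setT s -> bdd s -> integ (fun x => f x * s x).
Proof. by move=> fi ms /bdd_bounded bs; have := integrableMl measurableT fi ms bs. Qed.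

Lemma rintD f g : integ f -> integ g -> rint m (fun x => f x + g x) = rint m f + rint m g.
Proof. by move=> fi gi; rewrite rint.unlock; have := RintegralD measurableT fi gi. Qed.

Lemma rintZ c f : integ f -> rint m (fun x => c * f x) = c * rint m f.
Proof. by move=> fi; rewrite rint.unlock; have := RintegralZl c measurableT fi. Qed.

Lemma rint_ext f g : f =1 g -> rint m f = rint m g.
Proof. by move=> /funext ->. Qed.

Lemma rintD_ext h f g : integ f -> integ g -> (forall x, h x = f x + g x) ->
  rint m h = rint m f + rint m g.
Proof. by move=> fi gi /funext ->; exact: rintD. Qed.

Lemma rintZ_ext c h f : integ f -> (forall x, h x = c * f x) -> rint m h = c * rint m f.
Proof. by move=> fi /funext ->; exact: rintZ. Qed.

Lemma integ_ext f g : f =1 g -> integ f -> integ g.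
Proof. by move=> /funext ->. Qed.

Lemma integ_norm f : integ f -> integ (fun x => `|f x|).
Proof. by move=> fi; have := integrable_norm fi. Qed.

Lemma rint_norm f : integ f -> `|rint m f| <= rint m (fun x => `|f x|).
Proof. by move=> fi; rewrite rint.unlock; have := le_normr_Rintegral measurableT fi. Qed.

Lemma rint_le f g : integ f -> integ g -> (forall x, f x <= g x) -> rint m f <= rint m g.
Proof. by move=> fi gi fg; rewrite rint.unlock; apply: le_Rintegral => // x _; exact: fg. Qed.

(** Domains become indicator factors, so that every integral is over the whole space and fits the
    product form of the Fubini lemmas. *)
Lemma integ_set (A : set T) f : measurable A ->
  m.-integrable A (EFin \o f) <-> integ (fun x => \1_A x * f x).
Proof.
move=> mA; rewrite /integ (integrable_mkcond _ mA).
rewrite (_ : (EFin \o f) \_ A = EFin \o (fun x => \1_A x * f x))//.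
by apply/funext => x; rewrite patchE /= indicE; case: ifP; rewrite ?mul1r ?mul0r.
Qed.

Lemma int_set (A : set T) f : measurable A -> integ (fun x => \1_A x * f x) ->
  (\int[m]_(x in A) (f x)%:E)%E = (rint m (fun x => \1_A x * f x))%:E.
Proof.
move=> mA fi; rewrite rint_EFin// integral_mkcond; apply: eq_integral => x _.
by rewrite patchE /= indicE; case: ifP; rewrite ?mul1r ?mul0r.
Qed.

End integ.

(** * Fubini for a product of two integrable factors and a bounded kernel *)

Section fubini_w.
Context d1 d2 (T1 : measurableType d1) (T2 : measurableType d2) (R : realType).
Variable m1 : {sigma_finite_measure set T1 -> \bar R}.
Variable m2 : {sigma_finite_measure set T2 -> \bar R}.
Variables (f : T1 -> R) (k : T2 -> R) (s : T1 * T2 -> R).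
Hypotheses (fi : integ m1 f) (ki : integ m2 k).
Hypotheses (ms : measurable_fun setT s) (bs : bdd s).

Let h := fun p : T1 * T2 => f p.1 * k p.2 * s p.

Let mf1 : measurable_fun setT (fun p : T1 * T2 => f p.1).
Proof. by apply: (measurableT_comp (integ_meas fi)); exact: measurable_fst. Qed.

Let mk2 : measurable_fun setT (fun p : T1 * T2 => k p.2).
Proof. by apply: (measurableT_comp (integ_meas ki)); exact: measurable_snd. Qed.

Let mh : measurable_fun setT h.
Proof. by apply: measurable_funM => //; exact: measurable_funM. Qed.

Lemma meas_section1 x : measurable_fun setT (fun y => s (x, y)).
Proof. exact: measurableT_comp. Qed.

Lemma meas_section2 y : measurable_fun setT (fun x => s (x, y)).
Proof. exact: measurableT_comp. Qed.

Let bs1 x : bdd (fun y => s (x, y)).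
Proof. by case: bs => M sM; exists M => y. Qed.

Let bs2 y : bdd (fun x => s (x, y)).
Proof. by case: bs => M sM; exists M => x. Qed.

Lemma integ_section1 x : integ m2 (fun y => k y * s (x, y)).
Proof. by apply: integ_mul => //; exact: meas_section1. Qed.

Lemma integ_section2 y : integ m1 (fun x => f x * s (x, y)).
Proof. by apply: integ_mul => //; exact: meas_section2. Qed.

(** With [M] a bound of [s], the integrand is dominated by [M * |f x| * |k y|], whose iterated
    integral is finite; Tonelli concludes. *)
Lemma integ_w : integ (m1 \x m2)%E h.
Proof.
case: bs => M sM.
have M0 : 0 <= M by rewrite (le_trans _ (sM point)).
apply/integrable12ltyP; first exact/measurable_EFinP.
pose I2 := rint m2 (fun y => `|k y|).
have key x : (\int[m2]_y `|(EFin \o h) (x, y)| <= (M * I2 * `|f x|)%:E)%E.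
  rewrite [leRHS](_ : _ = (\int[m2]_y (M * `|f x| * `|k y|)%:E)%E).
    apply: ge0_le_integral => //=.
    - by apply/measurable_EFinP; apply: measurableT_comp => //; apply: (measurableT_comp mh).
    - apply/measurable_EFinP; apply: measurable_funM => //.
      by apply: measurableT_comp => //; exact: integ_meas ki.
    - move=> y _; rewrite lee_fin /h /= !normrM.
      have := sM (x, y); have := normr_ge0 (f x); have := normr_ge0 (k y) => ? ? ?.
      by rewrite mulrC mulrA ler_wpM2r// ler_wpM2r.
  rewrite -rint_EFin; last exact/integZ/integ_norm.
  by rewrite rintZ ?/I2; [congr EFin; ring|exact: integ_norm].
apply: (@le_lt_trans _ _ (\int[m1]_x (M * I2 * `|f x|)%:E)%E).
  apply: ge0_le_integral => //=.
  - by move=> x _; exact: integral_ge0.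
  - apply: (measurable_fun_fubini_tonelli_F (abse \o (EFin \o h))) => //=.
    by apply: measurableT_comp => //; exact/measurable_EFinP.
  - apply/measurable_EFinP; apply: measurable_funM => //.
    by apply: measurableT_comp => //; exact: integ_meas fi.
  - by move=> x _; exact: key.
by rewrite -rint_EFin ?ltry//; exact/integZ/integ_norm.
Qed.

Let inner1 x : (\int[m2]_y (h (x, y))%:E)%E = (f x * rint m2 (fun y => k y * s (x, y)))%:E.
Proof.
have i1 := integ_section1 x.
rewrite -(rintZ _ i1) rint_EFin; last exact: integZ.
by apply: eq_integral => y _; rewrite /h /= mulrA.
Qed.

Let inner2 y : (\int[m1]_x (h (x, y))%:E)%E = (k y * rint m1 (fun x => f x * s (x, y)))%:E.
Proof.
have i1 := integ_section2 y.
rewrite -(rintZ _ i1) rint_EFin; last exact: integZ.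
by apply: eq_integral => x _; rewrite /h /= (mulrC (f x)) mulrA.
Qed.

Lemma integ_outer1 : integ m1 (fun x => f x * rint m2 (fun y => k y * s (x, y))).
Proof.
have := integrable_fubini_F integ_w; rewrite /fubini_F.
by apply: eq_integrable => // x _; rewrite /= inner1.
Qed.

Lemma fubini_w1 :
  rint (m1 \x m2)%E h = rint m1 (fun x => f x * rint m2 (fun y => k y * s (x, y))).
Proof.
apply: EFin_inj; rewrite rint_EFin; last exact: integ_w.
rewrite rint_EFin; last exact: integ_outer1.
rewrite -(integral12_prod_meas1 integ_w); apply: eq_integral => x _.
by rewrite -inner1.
Qed.

Lemma fubini_w2 :
  rint (m1 \x m2)%E h = rint m2 (fun y => k y * rint m1 (fun x => f x * s (x, y))).
Proof.
rewrite [LHS]rintE [RHS]rintE; congr fine.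
rewrite -(integral21_prod_meas1 integ_w); apply: eq_integral => y _.
by rewrite -inner2.
Qed.

End fubini_w.

(* The [sigma_finite] instance of the library for [m1 \x m2] is shadowed by the one for subprobabilities,
   hence this alias. *)
Definition leb2 (R : realType) : set (measurableTypeR R * measurableTypeR R) -> \bar R :=
  (@lebesgue_measure R \x @lebesgue_measure R)%E.

HB.instance Definition _ (R : realType) := Measure.on (@leb2 R).

(** The squares of an increasing exhaustion of the line cover the plane: a point lies in the square
    of the larger of its two indices. *)
Lemma sigma_finite_leb2 (R : realType) : sigma_finite setT (@leb2 R).
Proof.
have /sigma_finiteP[F [TF ndF Foo]] := @sigma_finiteT _ _ _ (@lebesgue_measure R).
exists (fun n => F n `*` F n).
  rewrite -setXTT TF predeqE => -[x y]; split => [[/= [n _ Fnx] [k _ Fky]]|[n _ []/= ? ?]].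
    by exists (maxn n k) => //; split; [move: x Fnx|move: y Fky]; apply/subsetPset/ndF;
      rewrite ?leq_maxl ?leq_maxr.
  by split; exists n.
move=> k; have [? ?] := Foo k; split; first exact: measurableX.
by rewrite /leb2 product_measure1E// lte_mul_pinfty// ge0_fin_numE.
Qed.

HB.instance Definition _ (R : realType) :=
  Measure_isSigmaFinite.Build _ _ _ (@leb2 R) (@sigma_finite_leb2 R).

(** * Measure and calculus on the line and the plane *)

Section real_line.
Variable R : realType.
Let mu := @lebesgue_measure R.

(** The sigma-algebra here is the product one, generated by rectangles. An open set of the plane
    belongs to it as the union of the countably many rational boxes that it contains. *)
Lemma cont_meas2 (f : R * R -> R) : continuous f -> measurable_fun setT f.
Proof.
move=> /continuousP cf; apply: (measurability _ (RGenOpens.measurableE R)).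
move=> _ [A [a [b ->]] <-]; rewrite setTI.
have : open (f @^-1` `]a, b[) by exact/cf/interval_open.
move: (f @^-1` _) => {A f cf} O oO.
pose B (q : (rat * rat) * (rat * rat)) : set (R * R) :=
  (`]ratr q.1.1, ratr q.1.2[ `*` `]ratr q.2.1, ratr q.2.2[)%classic.
have -> : O = \bigcup_q (if `[< B q `<=` O >] then B q else set0).
  apply/seteqP; split => [[t x] Op|[t x] [q _]]; last first.
    by case: ifP => // /asboolP; exact.
  have /nbhs_ballP[e /= e0 eO] : nbhs (t, x) O by exact: open_nbhs_nbhs.
  have [q1] := @rat_in_itvoo _ (t - e) t ltac:(lra).
  have [q2] := @rat_in_itvoo _ t (t + e) ltac:(lra).
  have [q3] := @rat_in_itvoo _ (x - e) x ltac:(lra).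
  have [q4] := @rat_in_itvoo _ x (x + e) ltac:(lra).
  rewrite !in_itv /= => /andP[h41 h42] /andP[h31 h32] /andP[h21 h22] /andP[h11 h12].
  exists ((q1, q2), (q3, q4)) => //.
  rewrite asboolT; first by split; rewrite /= in_itv /=; apply/andP.
  move=> [t' x'] [/=]; rewrite !in_itv /= => /andP[a1 a2] /andP[a3 a4].
  apply: eO; split; rewrite /ball /= ltr_norml; apply/andP; split; lra.
apply: countable_bigcupT_measurable; first exact: countableP.
move=> q; case: ifP => // _; apply: measurableX; exact: measurable_itv.
Qed.

Lemma lebesgue_translate (c : R) (A : set R) : measurable A ->
  pushforward mu ((fun x => x + c) : _ -> measurableTypeR R) A = mu A.
Proof.
move=> mA; apply/esym/lebesgue_measure_unique => //=.
  by apply: measurable_funD.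
move=> ? _ [[a b]] _ <-.
rewrite /pushforward (_ : _ @^-1` _ = `](a - c), (b - c)]%classic); last first.
  by apply/seteqP; split => x /=; rewrite !in_itv /= => /andP[? ?]; apply/andP; split; lra.
rewrite !lebesgue_measure_itv/= !lte_fin ltrD2r.
by case: ifP => // _; rewrite -!EFinD; congr EFin; ring.
Qed.


Lemma meas_translate (c : R) : measurable_fun setT (fun x : R => x + c).
Proof. exact: measurable_funD. Qed.

Lemma rint_translate (c : R) (f : R -> R) : integ mu f -> rint mu (fun x => f (x + c)) = rint mu f.
Proof.
move=> fi; rewrite [LHS]rintE [RHS]rintE; congr fine.
pose tau : R -> measurableTypeR R := fun x => x + c.
have tr : measurable_fun setT tau := meas_translate c.
have ppi : (pushforward mu tau).-integrable setT (EFin \o f).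
  move: fi; rewrite /integ => /integrableP[mf foo]; apply/integrableP; split => //.
  rewrite (eq_measure_integral mu)// => A mA _; exact: lebesgue_translate.
have ppi' : mu.-integrable setT ((EFin \o f) \o tau).
  move: (fi) => /integrableP[mf foo]; apply/integrableP; split => //.
    by apply: (measurableT_comp mf).
  move: ppi => /integrableP[_]; rewrite ge0_integral_pushforward//.
  exact: measurableT_comp.
transitivity (\int[pushforward mu tau]_y ((EFin \o f) y))%E.
  rewrite integral_pushforward//; last by apply/measurable_EFinP; exact: integ_meas fi.
by apply: eq_measure_integral => A mA _; exact: lebesgue_translate.
Qed.

Lemma integ_itv (p q : R) : integ mu (\1_`[p, q]).
Proof. exact: integrable_indic_itv. Qed.

Lemma integ_itvoo (p q : R) : integ mu (\1_`]p, q[).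
Proof. exact: integrable_indic_itv. Qed.

Lemma in_indic_itv (p q x : R) : p <= x <= q -> \1_`[p, q] x = 1 :> R.
Proof. by move=> h; rewrite indicE mem_set// /= in_itv. Qed.

Lemma notin_indic_itv (p q x : R) : ~ p <= x <= q -> \1_`[p, q] x = 0 :> R.
Proof. by move=> h; rewrite indicE memNset//= in_itv /=. Qed.

Lemma in_indic_itvoo (p q x : R) : p < x < q -> \1_`]p, q[ x = 1 :> R.
Proof. by move=> h; rewrite indicE mem_set// /= in_itv. Qed.

Lemma notin_indic_itvoo (p q x : R) : ~ p < x < q -> \1_`]p, q[ x = 0 :> R.
Proof. by move=> h; rewrite indicE memNset//= in_itv /=. Qed.

(** Bridge between the open intervals of [strip] and [BVloc] and the closed ones on which [rint_FTC]
    works. *)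
Lemma rint_oo_cc (p q : R) (f : R -> R) : measurable_fun setT f -> bdd f ->
  rint mu (fun x => \1_`]p, q[ x * f x) = rint mu (fun x => \1_`[p, q] x * f x).
Proof.
move=> mf bf; apply: EFin_inj.
rewrite -!int_set//; [|by apply: integ_mul => //; exact: integ_itv|
  by apply: integ_mul => //; exact: integ_itvoo].
by apply/esym/integral_itv_bndoo; apply/measurable_EFinP; exact: measurable_funS mf.
Qed.

Lemma rint_FTC (F f : R -> R) (p q : R) : p <= q -> {within `[p, q], continuous f} ->
  (forall x, p <= x <= q -> is_derive x 1 F (f x)) ->
  rint mu (fun x => \1_`[p, q] x * f x) = F q - F p.
Proof.
move=> pq cf dF.
have fi : integ mu (fun x => \1_`[p, q] x * f x).
  apply: (iffLR (@integ_set _ _ _ mu `[p, q]%classic f (measurable_itv _))).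
  by apply: continuous_compact_integrable => //; exact: segment_compact.
have cF x : p <= x <= q -> {for x, continuous F}.
  by move=> /dF [+ _] => /derivable1_diffP/differentiable_continuous.
apply: EFin_inj; rewrite -int_set//.
move: pq; rewrite le_eqVlt => /predU1P[<-|pq].
  by rewrite set_itv1 integral_set1 subrr.
rewrite (@continuous_FTC2 _ _ F _ _ pq cf) ?EFinB//; last first.
  move=> x; rewrite in_itv /= => /andP[px xq]; rewrite derive1E.
  by have [_ ->] := dF x ltac:(by rewrite !ltW).
split.
- move=> x; rewrite in_itv /= => /andP[px xq].
  by have [] := dF x ltac:(by rewrite !ltW).
- by apply: cvg_at_right_filter; apply: cF; rewrite lexx ltW.
- by apply: cvg_at_left_filter; apply: cF; rewrite lexx ltW.
Qed.

(** Stated for endpoints in either order, because the increment in a difference quotient has either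
    sign. *)
Lemma MVT_between (F f : R -> R) (p q : R) : (forall x : R, is_derive x 1 F (f x)) ->
  exists2 c, `|c - p| <= `|q - p| & F q - F p = f c * (q - p).
Proof.
move=> dF.
have cF : continuous F.
  by move=> x; have [/derivable1_diffP/differentiable_continuous] := dF x.
have cFw u v : {within `[u, v], continuous F} by exact: continuous_subspaceT.
have [pq|qp] := leP p q.
  have [c] := MVT_segment pq (fun x _ => dF x) (cFw _ _).
  by rewrite in_itv /= => /andP[pc cq] ->; exists c => //; rewrite !ger0_norm ?subr_ge0//; lra.
have [c] := MVT_segment (ltW qp) (fun x _ => dF x) (cFw _ _).
rewrite in_itv /= => /andP[pc cq] e; exists c; last by lra.
by rewrite !ler0_norm; lra.
Qed.

(** [C1_2] only provides continuous partial derivatives. The increment is split into a move in space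
    at time [t] and a move in time at the new position; the mean value theorem applies to each, and
    continuity of the partials finishes. *)
Lemma is_derive_line (phi : R -> R -> R) (z s t : R) : C1_2 phi ->
  is_derive t 1 (fun r => phi r (z + s * r)) (dt phi t (z + s * t) + s * dx phi t (z + s * t)).
Proof.
move=> [dphi _ ct cx]; set x := z + s * t.
have cvgD : (fun h : R => h^-1 *: (phi (h *: 1 + t) (z + s * (h *: 1 + t)) - phi t x)) @ 0^'
    --> dt phi t x + s * dx phi t x.
  (* The two errors add up to [e' + |s| * e'], which this choice of [e'] makes equal to [e / 2]. *)
  have key (e : R) : 0 < e -> \forall h \near (0 : R)^',
      `|(h^-1 *: (phi (h *: 1 + t) (z + s * (h *: 1 + t)) - phi t x)) - (dt phi t x + s * dx phi t x)| <= e.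
    move=> e0; pose e' := e / (2 * (1 + `|s|)).
    have s0 : 0 < 1 + `|s| by rewrite ltr_pwDl.
    have e'0 : 0 < e' by rewrite divr_gt0// mulr_gt0.
    have /cvgrPdist_lt/(_ _ e'0)/nbhs_ballP[d1 /= d10 h1] := ct (t, x).
    have /cvgrPdist_lt/(_ _ e'0)/nbhs_ballP[d2 /= d20 h2] := cx (t, x).
    (* Dividing by [1 + |s|] keeps both displacements, [h] in time and [s * h] in space, below [d1]
       and [d2]. *)
    pose d := Num.min d1 d2 / (1 + `|s|).
    have d0 : 0 < d by rewrite divr_gt0// lt_min d10.
    near=> h.
    have h0 : h != 0 by near: h; exact: nbhs_dnbhs_neq.
    have hd : `|h| < d by near: h; apply: dnbhs0_lt.
    have hd' : `|h| * (1 + `|s|) < Num.min d1 d2 by rewrite -ltr_pdivlMr.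
    have shd : `|s * h| < Num.min d1 d2.
      by apply: le_lt_trans hd'; rewrite normrM mulrC ler_wpM2l//; lra.
    have hhd : `|h| < Num.min d1 d2.
      by apply: le_lt_trans hd'; rewrite ler_peMr//; have := normr_ge0 s; lra.
    rewrite scaler1.
    have [r1 r1d E1] := @MVT_between (fun r => phi r (z + s * (h + t))) (fun r => dt phi r (z + s * (h + t)))
       t (h + t) (fun r => DeriveDef (dphi r (z + s * (h + t))).1 (esym (derive1E _ _))).
    have [r2 r2d E2] := @MVT_between (fun y => phi t y) (fun y => dx phi t y)
       x (z + s * (h + t)) (fun y => DeriveDef (dphi t y).2 (esym (derive1E _ _))).
    rewrite addrK in r1d E1.
    have xE : z + s * (h + t) - x = s * h by rewrite /x; ring.
    rewrite xE in r2d E2.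
    rewrite (_ : phi _ _ - _ = h * (dt phi r1 (z + s * (h + t)) + s * dx phi t r2)); last first.
      rewrite (_ : h * _ = dt phi r1 (z + s * (h + t)) * h + dx phi t r2 * (s * h)); last by ring.
      by rewrite -E1 -E2; ring.
    rewrite -[_ *: _]/(_ * _) mulrA mulVf// mul1r.
    have a1 : `|dt phi r1 (z + s * (h + t)) - dt phi t x| < e'.
      rewrite distrC; apply: (h1 (r1, z + s * (h + t))); split; rewrite /ball /=.
        by rewrite distrC; apply: le_lt_trans r1d (lt_le_trans hhd _); rewrite ge_min lexx.
      by rewrite distrC xE (lt_le_trans shd)// ge_min lexx.
    have a2 : `|dx phi t r2 - dx phi t x| < e'.
      rewrite distrC; apply: (h2 (t, r2)); split; rewrite /ball /=.
        by rewrite subrr normr0.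
      by rewrite distrC; apply: le_lt_trans r2d (lt_le_trans shd _); rewrite ge_min lexx orbT.
    rewrite (_ : _ - _ = (dt phi r1 (z + s * (h + t)) - dt phi t x) + s * (dx phi t r2 - dx phi t x)); last by ring.
    apply: le_trans (ler_normD _ _) _; rewrite normrM.
    apply: (@le_trans _ _ (e' + `|s| * e')); first by apply: lerD; [exact: ltW|rewrite ler_wpM2l ?normr_ge0 ?ltW].
    rewrite (_ : e' + _ = e / 2); first by lra.
    by rewrite /e'; field; rewrite gt_eqF.
  apply/cvgrPdist_le => e e0; have := key _ e0; apply: filterS => h; by rewrite distrC.
apply: DeriveDef; first by apply/cvg_ex; eexists; exact: cvgD.
by apply: cvg_lim.
Unshelve. all: by end_near. Qed.

Lemma supp_bdd (k : R * R -> R) (a b c d : R) : continuous k ->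
  (forall t x, ~ (a <= t <= b /\ c <= x <= d) -> k (t, x) = 0) -> bdd k.
Proof.
move=> ck k0.
have cB : compact (`[a, b] `*` `[c, d]) by apply: compact_setX; exact: segment_compact.
have /compact_bounded[M [_ hM]] : compact (k @` (`[a, b] `*` `[c, d])).
  by apply: continuous_compact => //; exact: continuous_subspaceT.
exists (`|M| + 1) => -[t x].
have [h|h] := pselect (a <= t <= b /\ c <= x <= d); last by rewrite k0// normr0 addr_ge0.
apply: hM; first by rewrite (le_lt_trans (ler_norm M))// ltrDl.
by exists (t, x) => //=; rewrite !in_itv.
Qed.

(** * Test functions *)

Section test.
Variables (phi : R -> R -> R) (a b c d : R).
Hypotheses (cphi : C1_2 phi) (sphi : supp_in phi a b c d).

(** The rectangle is closed, so at a time outside [[a, b]] the function vanishes on a whole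
    neighbourhood; at a position outside [[c, d]] it vanishes at all times. *)
Lemma supp_dt t x : ~ (a <= t <= b /\ c <= x <= d) -> dt phi t x = 0.
Proof.
move=> h; rewrite /dt derive1E.
have [hx|hx] := pselect (c <= x <= d); last first.
  rewrite (_ : (fun s => phi s x) = cst 0) ?derive_cst//.
  by apply/funext => s; apply: sphi => -[].
rewrite (@near_eq_derive _ _ _ _ (cst 0)) ?derive_cst//.
have [ht|ht] := pselect (a <= t); last first.
  have ta : t < a by rewrite ltNge; apply/negP.
  near=> s; apply: sphi => -[/andP[+ _] _]; apply/negP; rewrite -ltNge.
  by near: s; exact: lt_nbhsl.
have bt : b < t by rewrite ltNge; apply/negP => tb; apply: h; rewrite ht.
near=> s; apply: sphi => -[/andP[_ +] _]; apply/negP; rewrite -ltNge.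
by near: s; exact: lt_nbhsr.
Unshelve. all: by end_near. Qed.

Lemma supp_dx t x : ~ (a <= t <= b /\ c <= x <= d) -> dx phi t x = 0.
Proof.
move=> h; rewrite /dx derive1E.
have [hx|hx] := pselect (a <= t <= b); last first.
  rewrite (_ : (fun s => phi t s) = cst 0) ?derive_cst//.
  by apply/funext => s; apply: sphi => -[].
rewrite (@near_eq_derive _ _ _ _ (cst 0)) ?derive_cst//.
have [ht|ht] := pselect (c <= x); last first.
  have ta : x < c by rewrite ltNge; apply/negP.
  near=> s; apply: sphi => -[_ /andP[+ _]]; apply/negP; rewrite -ltNge.
  by near: s; exact: lt_nbhsl.
have bt : d < x by rewrite ltNge; apply/negP => tb; apply: h; rewrite ht.
near=> s; apply: sphi => -[_ /andP[_ +]]; apply/negP; rewrite -ltNge.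
by near: s; exact: lt_nbhsr.
Unshelve. all: by end_near. Qed.

Lemma bdd_dt : bdd (fun p : R * R => dt phi p.1 p.2).
Proof. by case: cphi => _ _ ct _; apply: supp_bdd ct _ => t x /supp_dt. Qed.

Lemma bdd_dx : bdd (fun p : R * R => dx phi p.1 p.2).
Proof. by case: cphi => _ _ _ cx; apply: supp_bdd cx _ => t x /supp_dx. Qed.

Lemma bdd_phi : bdd (fun p : R * R => phi p.1 p.2).
Proof. by case: cphi => _ cp _ _; apply: supp_bdd cp _ => t x /sphi. Qed.

Lemma meas_dt : measurable_fun setT (fun p : R * R => dt phi p.1 p.2).
Proof. by apply: cont_meas2; case: cphi. Qed.

Lemma meas_dx : measurable_fun setT (fun p : R * R => dx phi p.1 p.2).
Proof. by apply: cont_meas2; case: cphi. Qed.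

Lemma meas_phi : measurable_fun setT (fun p : R * R => phi p.1 p.2).
Proof. by apply: cont_meas2; case: cphi. Qed.

End test.

(** * Travelling steps and their superpositions *)

Definition step (y x : R) : R := if y <= x then 1 else 0.

Lemma bdd_step {U : Type} (f g : U -> R) : bdd (fun p => step (f p) (g p)).
Proof. by exists 1 => p; rewrite /step; case: ifP; rewrite ?normr0 ?normr1. Qed.

Lemma meas_step d' (U : measurableType d') (f g : U -> R) :
  measurable_fun setT f -> measurable_fun setT g ->
  measurable_fun setT (fun p => step (f p) (g p)).
Proof. by move=> mf mg; apply: measurable_fun_ifT => //; exact: measurable_fun_ler. Qed.

Lemma bddM {U : Type} (f g : U -> R) : bdd f -> bdd g -> bdd (fun p => f p * g p).
Proof. by move=> [M hM] [N hN]; exists (M * N) => p; rewrite normrM ler_pM. Qed.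

Lemma bddD {U : Type} (f g : U -> R) : bdd f -> bdd g -> bdd (fun p => f p + g p).
Proof. by move=> [M hM] [N hN]; exists (M + N) => p; rewrite (le_trans (ler_normD _ _))// lerD. Qed.

Lemma bdd_cst {U : Type} (c : R) : bdd (fun _ : U => c).
Proof. by exists `|c|. Qed.

Lemma bdd_comp {U V : Type} (f : V -> R) (g : U -> V) : bdd f -> bdd (fun p => f (g p)).
Proof. by move=> [M hM]; exists M => p. Qed.

(** The strip has infinite measure. Cutting it in space, which changes nothing for a test function
    supported in [[c, d]], makes its indicator an integrable product of two functions of one
    variable. *)
Definition chi (T c d : R) (p : R * R) : R := \1_`]0, T[ p.1 * \1_`[c, d] p.2.

Lemma chi_notin_time (T c d : R) (p : R * R) : ~ 0 < p.1 < T -> chi T c d p = 0.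
Proof. by move=> h; rewrite /chi notin_indic_itvoo// mul0r. Qed.

Lemma integ_chi (T c d : R) (s : R * R -> R) : measurable_fun setT s -> bdd s ->
  integ (mu \x mu)%E (fun p => chi T c d p * s p).
Proof. by move=> ms bs; apply: integ_w => //; [exact: integ_itvoo|exact: integ_itv]. Qed.

Lemma rint_chi1 (T c d : R) (s : R * R -> R) : measurable_fun setT s -> bdd s ->
  rint (mu \x mu)%E (fun p => chi T c d p * s p) =
  rint mu (fun t => \1_`]0, T[ t * rint mu (fun x => \1_`[c, d] x * s (t, x))).
Proof. by move=> ms bs; apply: fubini_w1 => //; [exact: integ_itvoo|exact: integ_itv]. Qed.

Lemma rint_chi2 (T c d : R) (s : R * R -> R) : measurable_fun setT s -> bdd s ->
  rint (mu \x mu)%E (fun p => chi T c d p * s p) =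
  rint mu (fun x => \1_`[c, d] x * rint mu (fun t => \1_`]0, T[ t * s (t, x))).
Proof. by move=> ms bs; apply: fubini_w2 => //; [exact: integ_itvoo|exact: integ_itv]. Qed.

Lemma cont_line (K : R * R -> R) (z s : R) : continuous K -> continuous (fun r : R => K (r, z + s * r)).
Proof.
move=> cK t; apply: (@continuous2_cvg _ _ _ _ _ _ (fun r => r) (fun r => z + s * r) (fun u v => K (u, v))).
- by rewrite (_ : (fun q : R * R => K (q.1, q.2)) = K); [exact: cK|apply/funext => -[]].
- exact: cvg_id.
- by apply: cvgD; [exact: cvg_cst|apply: cvgM; [exact: cvg_cst|exact: cvg_id]].
Qed.

Lemma cont_section (K : R * R -> R) (t : R) : continuous K -> continuous (fun r : R => K (t, r)).
Proof.
move=> cK x; apply: (@continuous2_cvg _ _ _ _ _ _ (fun=> t) (fun r => r) (fun u v => K (u, v))).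
- by rewrite (_ : (fun q : R * R => K (q.1, q.2)) = K); [exact: cK|apply/funext => -[]].
- exact: cvg_cst.
- exact: cvg_id.
Qed.

(** * Identities for a single travelling step *)

Section ray.
Variables (phi : R -> R -> R) (a b c d T y s : R).
Hypotheses (cphi : C1_2 phi) (sphi : supp_in phi a b c d).

Let mline : measurable_fun setT (fun p : R * R => step (y + s * p.1) p.2).
Proof.
by apply: meas_step => //; apply: measurable_funD => //; exact: measurable_funM.
Qed.

(** In the moving frame [x = z + s * t] the step no longer depends on time, and the bracket is the
    time derivative of [phi t (z + s * t)]. Its integral over [[0, T]] is [- phi 0 z], since [phi]
    vanishes at [T > b]. *)
Lemma ray_weak : 0 < T -> b < T ->
  rint (mu \x mu)%E (fun p => chi T c d p *
    (step (y + s * p.1) p.2 * (dt phi p.1 p.2 + s * dx phi p.1 p.2))) =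
  - rint mu (fun x => \1_`[c, d] x * (step y x * phi 0 x)).
Proof.
move=> T0 bT.
pose K (p : R * R) := dt phi p.1 p.2 + s * dx phi p.1 p.2.
have mK : measurable_fun setT K.
  by apply: measurable_funD; [exact: meas_dt cphi|apply: measurable_funM => //; exact: meas_dx cphi].
have bK : bdd K.
  by apply: bddD; [exact: bdd_dt cphi sphi|apply: bddM; [exact: bdd_cst|exact: bdd_dx cphi sphi]].
have K0 t x : ~ c <= x <= d -> K (t, x) = 0.
  by move=> h; rewrite /K (supp_dt sphi) ?(supp_dx sphi) ?mulr0 ?addr0// => -[].
(* The frame shifts the window [[c, d]] by at most [|s| * T], so [[C, D]] contains every shifted
   copy and does not depend on [t]. *)
pose C := c - `|s| * T; pose D := d + `|s| * T.
have sT t : 0 < t < T -> `|s * t| <= `|s| * T.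
  by move=> /andP[t0 tT]; rewrite normrM ler_wpM2l ?normr_ge0 // ger0_norm ltW.
have mline2 : measurable_fun setT (fun p : R * R => (p.1, p.2 + s * p.1)).
  by apply: measurable_fun_pair => //; apply: measurable_funD => //; exact: measurable_funM.
pose S (p : R * R) := step y p.2 * K (p.1, p.2 + s * p.1).
have mS : measurable_fun setT S.
  apply: measurable_funM; first exact: meas_step.
  by apply: (measurableT_comp mK).
have bS : bdd S by apply: bddM; [exact: bdd_step|exact: (bdd_comp _ bK)].
have mk : measurable_fun setT (fun p => step (y + s * p.1) p.2 * K p) by exact: measurable_funM.
have bk : bdd (fun p => step (y + s * p.1) p.2 * K p) by apply: bddM => //; exact: bdd_step.
rewrite rint_chi1//.
transitivity (rint mu (fun t => \1_`]0, T[ t * rint mu (fun z => \1_`[C, D] z * S (t, z)))).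
  apply: rint_ext => t; have [tT|tT] := pselect (0 < t < T); last by rewrite notin_indic_itvoo// !mul0r.
  congr (_ * _); rewrite -(rint_translate (s * t)); last first.
    apply: integ_mul; [exact: integ_itv|exact: (meas_section1 mk)|exact: bdd_comp (pair t) bk].
  apply: rint_ext => z; rewrite /S /=.
  rewrite (_ : step (y + s * t) (z + s * t) = step y z); last by rewrite /step lerD2r.
  have [h|h] := pselect (c <= z + s * t <= d).
    rewrite !in_indic_itv//; rewrite /C /D; have := sT _ tT; move: h.
    by rewrite ler_norml => /andP[? ?] /andP[? ?]; apply/andP; split; lra.
  by rewrite -[dt phi t _ + _]/(K (t, z + s * t)) K0// !mulr0.
rewrite -rint_chi1// rint_chi2//.
have -> : - rint mu (fun x => \1_`[c, d] x * (step y x * phi 0 x)) =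
    rint mu (fun x => (-1) * (\1_`[c, d] x * (step y x * phi 0 x))).
  rewrite rintZ ?mulN1r//; apply: integ_mul.
  - exact: integ_itv.
  - by apply: measurable_funM; [exact: meas_step|exact: (meas_section1 (meas_phi cphi))].
  - by apply: bddM; [exact: bdd_step|exact: bdd_comp (pair 0) (bdd_phi cphi sphi)].
apply: rint_ext => z.
transitivity (\1_`[C, D] z * (step y z * - phi 0 z)).
  congr (_ * _).
  have mz : measurable_fun setT (fun t => K (t, z + s * t)).
    apply: (measurableT_comp mK); apply: measurable_fun_pair => //.
    by apply: measurable_funD => //; exact: measurable_funM.
  have bz : bdd (fun t => K (t, z + s * t)) by exact: (bdd_comp _ bK).
  transitivity (rint mu (fun t => step y z * (\1_`]0, T[ t * K (t, z + s * t)))).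
    by apply: rint_ext => t; rewrite /S /=; ring.
  rewrite rintZ; last by apply: integ_mul => //; exact: integ_itvoo.
  congr (_ * _); rewrite rint_oo_cc//.
  have cz : {within `[0, T], continuous (fun t => K (t, z + s * t))}.
    apply: continuous_subspaceT; apply: cont_line.
    case: cphi => _ _ c1 c2 p; apply: cvgD; first exact: c1.
    by apply: cvgM; [exact: cvg_cst|exact: c2].
  have := rint_FTC (ltW T0) cz (fun t _ => is_derive_line z s t cphi).
  rewrite (sphi (t := T)) ?mulr0 ?addr0 ?sub0r => [|[/andP[_ +] _]]; last by apply/negP; rewrite -ltNge.
  exact.
have [h|h] := pselect (c <= z <= d).
  rewrite !in_indic_itv//; first by ring.
  have : 0 <= `|s| * T by rewrite mulr_ge0// ltW.
  by move: h; rewrite /C /D => /andP[? ?] ?; apply/andP; split; lra.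
by rewrite sphi; [rewrite oppr0 !mulr0|move=> []].
Qed.

Lemma ray_ibp (t z : R) :
  rint mu (fun x => \1_`[c, d] x * (step z x * dx phi t x)) = - phi t z.
Proof.
(* A point to the right of the step and strictly beyond the support, where the boundary term
   [phi t m] vanishes. *)
pose m := Num.max z d + 1.
have zmax : z <= Num.max z d by rewrite le_max lexx.
have dmax : d <= Num.max z d by rewrite le_max lexx orbT.
have zm : z <= m by rewrite /m; lra.
have dm : d < m by rewrite /m; lra.
transitivity (rint mu (fun x => \1_`[z, m] x * dx phi t x)).
  apply: rint_ext => x; have [h|h] := pselect (c <= x <= d); last first.
    by rewrite (supp_dx sphi) ?mulr0// => -[].
  rewrite in_indic_itv// mul1r /step; case: ifPn => zx.
    by rewrite in_indic_itv// zx/=; move: h => /andP[_ /le_lt_trans/(_ dm)/ltW].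
  by rewrite notin_indic_itv// => /andP[]; rewrite (negbTE zx).
case: (cphi) => dphi _ _ cx.
have cz : {within `[z, m], continuous (fun x => dx phi t x)}.
  by apply: continuous_subspaceT; apply: cont_section (cx).
have := @rint_FTC (fun x => phi t x) _ _ _ zm cz.
rewrite (sphi (x := m)) ?sub0r => [|[_ /andP[_]]]; last by apply/negP; rewrite -ltNge.
by apply => x _; apply: (DeriveDef (dphi t x).2); rewrite /dx derive1E.
Qed.

(** The space integral is [- phi t (y + s * t)], at most 1 in size and zero unless [a <= t <= b].
    The bound does not involve [y] or [s], hence survives superposition. *)
Lemma ray_dx : a < b -> (forall t x, `|phi t x| <= 1) ->
  `|rint (mu \x mu)%E (fun p => chi T c d p * (step (y + s * p.1) p.2 * dx phi p.1 p.2))| <= b - a.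
Proof.
move=> ab phi1.
have mk : measurable_fun setT (fun p : R * R => step (y + s * p.1) p.2 * dx phi p.1 p.2).
  by apply: measurable_funM => //; exact: meas_dx cphi.
have bk : bdd (fun p : R * R => step (y + s * p.1) p.2 * dx phi p.1 p.2).
  by apply: bddM; [exact: bdd_step|exact: bdd_dx cphi sphi].
have iv := integ_outer1 (integ_itvoo 0 T) (integ_itv c d) mk bk.
rewrite rint_chi1//; apply: (le_trans (rint_norm iv)).
have -> : b - a = rint mu (\1_`[a, b]).
  apply: EFin_inj; rewrite rint_EFin; last exact: integ_itv.
  by rewrite integral_indic//= setIT lebesgue_measure_itv /= lte_fin ab EFinB.
apply: rint_le; [exact: integ_norm|exact: integ_itv|move=> t /=].
rewrite (ray_ibp t (y + s * t)).
have [h|h] := pselect (a <= t <= b); last first.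
  by rewrite sphi ?oppr0 ?mulr0 ?normr0 ?indicE ?ler0n// => -[].
rewrite in_indic_itv// normrM normrN.
by rewrite -[leRHS]mulr1 ler_pM// indicE normr_nat lern1; case: (_ \in _).
Qed.

End ray.

(** Dual form of a bound [M], uniform in time, on the variation in [x]; [b - a] is the duration of
    the test function. *)
Definition xvar (T : R) (w : R -> R -> R) : Prop :=
  exists M : R, forall (phi : R -> R -> R) (a b c d : R), C1_2 phi -> a < b ->
    supp_in phi a b c d -> (forall t x, `|phi t x| <= 1) ->
    `|rint (mu \x mu)%E (fun p => chi T c d p * (w p.1 p.2 * dx phi p.1 p.2))| <= M * (b - a).

Definition weakR (T : R) (w g : R -> R -> R) : Prop :=
  forall (phi : R -> R -> R) (a b c d : R), C1_2 phi -> b < T -> supp_in phi a b c d ->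
    rint (mu \x mu)%E (fun p => chi T c d p *
      (w p.1 p.2 * dt phi p.1 p.2 + g p.1 p.2 * dx phi p.1 p.2)) =
    - rint mu (fun x => \1_`[c, d] x * (w 0 x * phi 0 x)).

Definition bmeas (w : R -> R -> R) : Prop := meas2 w /\ bdd (fun p : R * R => w p.1 p.2).

(** The integrated conservation law on [[p, q]]. The boundary fluxes are frozen at time 0, which is
    right when no front crosses [p] or [q] before [T]. *)
Definition balanced (T p q : R) (w g : R -> R -> R) : Prop :=
  forall t, 0 <= t < T ->
    rint mu (fun x => \1_`[p, q] x * w t x) =
    rint mu (fun x => \1_`[p, q] x * w 0 x) + t * (g 0 p - g 0 q).

(** The variation of the flux is recorded because, through the equation, it controls the variation
    of [w] in time. *)
Definition good (T : R) (w g : R -> R -> R) : Prop :=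
  [/\ bmeas w /\ bmeas g, weakR T w g & xvar T w /\ xvar T g].

Lemma bmeasD w1 w2 : bmeas w1 -> bmeas w2 -> bmeas (fun t x => w1 t x + w2 t x).
Proof. by move=> [m1 b1] [m2 b2]; split; [exact: measurable_funD|exact: bddD]. Qed.

Lemma bmeas_cst k : bmeas (fun _ _ => k).
Proof. by split; [exact: measurable_cst|exact: bdd_cst]. Qed.

Lemma bmeasZ k w : bmeas w -> bmeas (fun t x => k * w t x).
Proof.
move=> [m1 b1]; split; first exact: measurable_funM.
by apply: bddM => //; exact: bdd_cst.
Qed.

Lemma bmeas_step y s : bmeas (fun t x => step (y + s * t) x).
Proof.
split; last exact: bdd_step.
by apply: meas_step => //; apply: measurable_funD => //; exact: measurable_funM.
Qed.

Lemma integ_bmeas (w : R -> R -> R) (k : R -> R) t : bmeas w -> integ mu k ->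
  integ mu (fun x => k x * w t x).
Proof.
move=> [mw bw] ki; apply: integ_mul => //; first exact: (meas_section1 mw).
exact: (bdd_comp (pair t) bw).
Qed.

Section with_test.
Variables (phi : R -> R -> R) (a b c d T : R).
Hypotheses (cphi : C1_2 phi) (sphi : supp_in phi a b c d).

Lemma integ_dt w : bmeas w -> integ (mu \x mu)%E (fun p => chi T c d p * (w p.1 p.2 * dt phi p.1 p.2)).
Proof.
move=> [mw bw]; apply: integ_chi; first by apply: measurable_funM => //; exact: meas_dt cphi.
by apply: bddM => //; exact: bdd_dt cphi sphi.
Qed.

Lemma integ_dx w : bmeas w -> integ (mu \x mu)%E (fun p => chi T c d p * (w p.1 p.2 * dx phi p.1 p.2)).
Proof.
move=> [mw bw]; apply: integ_chi; first by apply: measurable_funM => //; exact: meas_dx cphi.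
by apply: bddM => //; exact: bdd_dx cphi sphi.
Qed.

Lemma integ_init w : bmeas w -> integ mu (fun x => \1_`[c, d] x * (w 0 x * phi 0 x)).
Proof.
move=> [mw bw]; apply: integ_mul; first exact: integ_itv.
  by apply: measurable_funM; [exact: (meas_section1 mw)|exact: (meas_section1 (meas_phi cphi))].
by apply: bddM; [exact: (bdd_comp (pair 0) bw)|exact: (bdd_comp (pair 0) (bdd_phi cphi sphi))].
Qed.

Lemma rint_weak_split w g : bmeas w -> bmeas g ->
  rint (mu \x mu)%E (fun p => chi T c d p *
      (w p.1 p.2 * dt phi p.1 p.2 + g p.1 p.2 * dx phi p.1 p.2)) =
  rint (mu \x mu)%E (fun p => chi T c d p * (w p.1 p.2 * dt phi p.1 p.2)) +
  rint (mu \x mu)%E (fun p => chi T c d p * (g p.1 p.2 * dx phi p.1 p.2)).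
Proof.
move=> bw bg; rewrite -rintD; [|exact: integ_dt|exact: integ_dx].
by apply: rint_ext => p; rewrite mulrDr.
Qed.

(** On the support a constant is a resting step placed at [c - 1]; this reduces constants to the
    case of one step. *)
Lemma step_below x : c <= x <= d -> step (c - 1) x = 1.
Proof. by move=> /andP[cx _]; rewrite /step ifT//; lra. Qed.

Lemma rint_dx0 : rint (mu \x mu)%E (fun p => chi T c d p * dx phi p.1 p.2) = 0.
Proof.
rewrite rint_chi1; [|exact: meas_dx cphi|exact: bdd_dx cphi sphi].
transitivity (rint mu (fun x : R => 0 * \1_`[c, d] x)); last first.
  by rewrite rintZ ?mul0r//; exact: integ_itv.
apply: rint_ext => t; rewrite mul0r /=.
transitivity (\1_`]0, T[ t * rint mu (fun x => \1_`[c, d] x * (step (c - 1) x * dx phi t x))).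
  congr (_ * _); apply: rint_ext => x.
  have [h|h] := pselect (c <= x <= d); last by rewrite notin_indic_itv// !mul0r.
  by rewrite step_below// mul1r.
rewrite (ray_ibp cphi sphi) sphi ?oppr0 ?mulr0// => -[_ /andP[+ _]].
by apply/negP; rewrite -ltNge; lra.
Qed.

Lemma rint_dt0 : 0 < T -> b < T ->
  rint (mu \x mu)%E (fun p => chi T c d p * dt phi p.1 p.2) =
  - rint mu (fun x => \1_`[c, d] x * phi 0 x).
Proof.
move=> T0 bT.
have := ray_weak (c - 1) 0 cphi sphi T0 bT.
rewrite (_ : (fun p => chi T c d p * (step (c - 1 + 0 * p.1) p.2 * (dt phi p.1 p.2 + 0 * dx phi p.1 p.2))) =
  fun p => chi T c d p * dt phi p.1 p.2); last first.
  apply/funext => p; rewrite !mul0r !addr0 /chi.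
  have [h|h] := pselect (c <= p.2 <= d); last by rewrite (notin_indic_itv h) !mulr0 !mul0r.
  by rewrite (step_below h) mul1r.
move=> ->; congr (- _); apply: rint_ext => x.
have [h|h] := pselect (c <= x <= d); last by rewrite notin_indic_itv// !mul0r.
by rewrite step_below// mul1r.
Qed.

End with_test.

Lemma xvarD T w1 w2 : bmeas w1 -> bmeas w2 -> xvar T w1 -> xvar T w2 ->
  xvar T (fun t x => w1 t x + w2 t x).
Proof.
move=> b1 b2 [M1 h1] [M2 h2]; exists (M1 + M2) => phi a b c d cphi ab sphi phi1.
have := h1 _ _ _ _ _ cphi ab sphi phi1; have := h2 _ _ _ _ _ cphi ab sphi phi1 => k2 k1.
rewrite (rintD_ext (integ_dx T cphi sphi b1) (integ_dx T cphi sphi b2)); last by move=> p /=; ring.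
by rewrite mulrDl; apply: le_trans (ler_normD _ _) (lerD k1 k2).
Qed.

Lemma xvarZ T k w : bmeas w -> xvar T w -> xvar T (fun t x => k * w t x).
Proof.
move=> b1 [M1 h1]; exists (`|k| * M1) => phi a b c d cphi ab sphi phi1.
rewrite (rintZ_ext (c := k) (integ_dx T cphi sphi b1)); last by move=> p /=; ring.
by rewrite normrM -mulrA ler_wpM2l ?normr_ge0//; exact: h1.
Qed.

Lemma goodD T w1 g1 w2 g2 : good T w1 g1 -> good T w2 g2 ->
  good T (fun t x => w1 t x + w2 t x) (fun t x => g1 t x + g2 t x).
Proof.
move=> [[bw1 bg1] W1 [xw1 xg1]] [[bw2 bg2] W2 [xw2 xg2]]; split.
- by split; exact: bmeasD.
- move=> phi a b c d cphi bT sphi.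
  have := W1 _ _ _ _ _ cphi bT sphi; have := W2 _ _ _ _ _ cphi bT sphi.
  rewrite (rint_weak_split T cphi sphi bw1 bg1) (rint_weak_split T cphi sphi bw2 bg2) => E2 E1.
  rewrite (rint_weak_split T cphi sphi (bmeasD bw1 bw2) (bmeasD bg1 bg2)).
  rewrite (rintD_ext (integ_dt T cphi sphi bw1) (integ_dt T cphi sphi bw2)); last by move=> p /=; ring.
  rewrite [X in _ + X = _](rintD_ext (integ_dx T cphi sphi bg1) (integ_dx T cphi sphi bg2)); last by move=> p /=; ring.
  rewrite [X in _ = - X](rintD_ext (integ_init cphi sphi bw1) (integ_init cphi sphi bw2)); last by move=> p /=; ring.
  by rewrite addrACA E1 E2 opprD.
- by split; exact: xvarD.
Qed.

Lemma good_cst T k k' : 0 < T -> good T (fun _ _ => k) (fun _ _ => k').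
Proof.
move=> T0.
have b1 := bmeas_cst 1.
have xc r : xvar T (fun _ _ => r).
  exists 0 => phi a b c d cphi ab sphi phi1; rewrite mul0r.
  have i1 : integ (mu \x mu)%E (fun p => chi T c d p * dx phi p.1 p.2).
    by apply: integ_chi; [exact: meas_dx cphi|exact: bdd_dx cphi sphi].
  rewrite (rintZ_ext (c := r) i1); last by move=> p /=; ring.
  by rewrite (rint_dx0 _ cphi sphi) ?mulr0 ?normr0.
split; [by split; exact: bmeas_cst| |by []].
move=> phi a b c d cphi bT sphi; rewrite (rint_weak_split _ cphi sphi); [|exact: bmeas_cst|exact: bmeas_cst].
have i1 : integ (mu \x mu)%E (fun p => chi T c d p * dx phi p.1 p.2).
  by apply: integ_chi; [exact: meas_dx cphi|exact: bdd_dx cphi sphi].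
have i2 : integ (mu \x mu)%E (fun p => chi T c d p * dt phi p.1 p.2).
  by apply: integ_chi; [exact: meas_dt cphi|exact: bdd_dt cphi sphi].
have i3 : integ mu (fun x => \1_`[c, d] x * phi 0 x).
  by have := integ_init cphi sphi b1; apply: integ_ext => x; rewrite mul1r.
rewrite (rintZ_ext (c := k) i2); last by move=> p /=; ring.
rewrite [X in _ + X = _](rintZ_ext (c := k') i1); last by move=> p /=; ring.
rewrite [X in _ = - X](rintZ_ext (c := k) i3); last by move=> p /=; ring.
by rewrite (rint_dt0 cphi sphi)// (rint_dx0 _ cphi sphi) mulr0 addr0 mulrN.
Qed.

Lemma rint_ray_split (phi : R -> R -> R) (a b c d T y s : R) : C1_2 phi -> supp_in phi a b c d ->
  rint (mu \x mu)%E (fun p => chi T c d p *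
    (step (y + s * p.1) p.2 * (dt phi p.1 p.2 + s * dx phi p.1 p.2))) =
  rint (mu \x mu)%E (fun p => chi T c d p * (step (y + s * p.1) p.2 * dt phi p.1 p.2)) +
  s * rint (mu \x mu)%E (fun p => chi T c d p * (step (y + s * p.1) p.2 * dx phi p.1 p.2)).
Proof.
move=> cphi sphi.
rewrite -(rintZ s (integ_dx T cphi sphi (bmeas_step y s))).
rewrite -(rintD (integ_dt T cphi sphi (bmeas_step y s)) (integZ s (integ_dx T cphi sphi (bmeas_step y s)))).
by apply: rint_ext => p /=; ring.
Qed.

Lemma xvar_step T y s : xvar T (fun t x => step (y + s * t) x).
Proof. by exists 1 => phi a b c d cphi ab sphi phi1; rewrite mul1r; exact: ray_dx. Qed.

Lemma good_ray T k y s : 0 < T ->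
  good T (fun t x => k * step (y + s * t) x) (fun t x => s * k * step (y + s * t) x).
Proof.
move=> T0; have bs := bmeas_step y s; split.
- by split; exact: bmeasZ.
- move=> phi a b c d cphi bT sphi.
  rewrite (rint_weak_split T cphi sphi (bmeasZ k bs) (bmeasZ (s * k) bs)).
  rewrite (rintZ_ext (c := k) (integ_dt T cphi sphi bs)); last by move=> p /=; ring.
  rewrite [X in _ + X = _](rintZ_ext (c := s * k) (integ_dx T cphi sphi bs)); last by move=> p /=; ring.
  rewrite [X in _ = - X](rintZ_ext (c := k) (integ_init cphi sphi bs)); last by move=> p /=; ring.
  have := ray_weak y s cphi sphi T0 bT; rewrite (rint_ray_split _ _ _ cphi sphi) mulr0 addr0 => E.
  by rewrite -mulrN -E; ring.
- by split; apply: xvarZ => //; exact: xvar_step.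
Qed.

(** The step stays on one side of each endpoint. Strict and weak inequalities follow [step], which
    equals 1 at its own position: it is then constant in time both at [p] and at [q]. *)
Definition noncross (T p q y s : R) : Prop :=
  [\/ (forall t, 0 <= t < T -> p < y + s * t <= q), (forall t, 0 <= t < T -> q < y + s * t) |
      (forall t, 0 <= t < T -> y + s * t <= p)].

Lemma rint_step_in (p q z : R) : p < z <= q -> rint mu (fun x => \1_`[p, q] x * step z x) = q - z.
Proof.
move=> /andP[pz zq].
transitivity (rint mu (\1_`[z, q])); last first.
  apply: EFin_inj; rewrite rint_EFin; last exact: integ_itv.
  rewrite integral_indic//= setIT lebesgue_measure_itv /= lte_fin.
  by case: ltP => [|qz]; rewrite ?EFinB//; congr EFin; lra.
apply: rint_ext => x /=; rewrite /step; case: ifPn => zx.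
  rewrite mulr1; have [xq|xq] := leP x q; first by rewrite !in_indic_itv ?zx ?xq// andbT; lra.
  by rewrite !notin_indic_itv//; lra.
by rewrite mulr0 notin_indic_itv// => /andP[]; rewrite (negbTE zx).
Qed.

Lemma rint_step_balance (T p q y s t : R) : p <= q -> noncross T p q y s -> 0 <= t < T ->
  rint mu (fun x => \1_`[p, q] x * step (y + s * t) x) =
  rint mu (fun x => \1_`[p, q] x * step y x) + t * (s * step y p - s * step y q).
Proof.
move=> pq nc tT.
have T0 : 0 <= (0 : R) < T by case/andP: tT => ? ?; apply/andP; split; lra.
case: nc => nc; have := nc t tT; have := nc 0 T0; rewrite mulr0 addr0 => n0 nt.
- rewrite !rint_step_in// /step; case/andP: n0 => n1 n2.
  by rewrite n2 leNgt n1 /=; ring.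
- rewrite /step !ifF ?(le_gtF _)//; last by lra.
  + rewrite mulr0 subr0 mulr0 addr0; apply: rint_ext => x.
    have [/andP[px xq]|h] := pselect (p <= x <= q); last by rewrite notin_indic_itv// !mul0r.
    by rewrite !ifF//; lra.
  + lra.
- rewrite /step !ifT//; last by lra.
  rewrite subrr mulr0 addr0; apply: rint_ext => x.
  have [/andP[px xq]|h] := pselect (p <= x <= q); last by rewrite notin_indic_itv// !mul0r.
  by rewrite !ifT//; lra.
Qed.

(** * Superposition of steps with density [f], positions [y] and speeds [l] *)

Section superposition.
Variables (T : R) (f y l : R -> R).
Hypotheses (fi : integ mu f) (fli : integ mu (fun z => f z * l z)).
Hypotheses (my : measurable_fun setT y) (ml : measurable_fun setT l).

(** The outer measure stays general: it is the plane measure for the weak equation, and the line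
    measure for the initial datum and the balance law. [tau] and [xi] read time and position off the
    outer variable. *)
Lemma rint_swap d' (Y : measurableType d') (m : {sigma_finite_measure set Y -> \bar R})
    (h : R -> R) (k tau xi : Y -> R) :
  integ mu h -> integ m k -> measurable_fun setT tau -> measurable_fun setT xi ->
  rint m (fun p => k p * rint mu (fun z => h z * step (y z + l z * tau p) (xi p))) =
  rint mu (fun z => h z * rint m (fun p => k p * step (y z + l z * tau p) (xi p))).
Proof.
move=> hi ki mtau mxi; pose s (q : R * Y) := step (y q.1 + l q.1 * tau q.2) (xi q.2).
have ms : measurable_fun setT s.
  apply: meas_step; last exact: measurableT_comp.
  apply: measurable_funD; first exact: measurableT_comp.
  by apply: measurable_funM; exact: measurableT_comp.
have bs : bdd s by exact: bdd_step.
by rewrite -(fubini_w2 hi ki ms bs) -(fubini_w1 hi ki ms bs).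
Qed.

Lemma integ_swap d' (Y : measurableType d') (m : {sigma_finite_measure set Y -> \bar R})
    (h : R -> R) (k tau xi : Y -> R) :
  integ mu h -> integ m k -> measurable_fun setT tau -> measurable_fun setT xi ->
  integ mu (fun z => h z * rint m (fun p => k p * step (y z + l z * tau p) (xi p))).
Proof.
move=> hi ki mtau mxi; pose s (q : R * Y) := step (y q.1 + l q.1 * tau q.2) (xi q.2).
have ms : measurable_fun setT s.
  apply: meas_step; last exact: measurableT_comp.
  apply: measurable_funD; first exact: measurableT_comp.
  by apply: measurable_funM; exact: measurableT_comp.
exact: (integ_outer1 hi ki ms (bdd_step _ _)).
Qed.

Lemma rint_swap2 (h : R -> R) (k : R * R -> R) : integ mu h -> integ (mu \x mu)%E k ->
  rint (mu \x mu)%E (fun p => k p * rint mu (fun z => h z * step (y z + l z * p.1) p.2)) =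
  rint mu (fun z => h z * rint (mu \x mu)%E (fun p => k p * step (y z + l z * p.1) p.2)).
Proof.
by move=> hi ki; apply: (@rint_swap _ _ (@leb2 R) h k fst snd hi ki); [exact: measurable_fst|exact: measurable_snd].
Qed.

Lemma integ_swap2 (h : R -> R) (k : R * R -> R) : integ mu h -> integ (mu \x mu)%E k ->
  integ mu (fun z => h z * rint (mu \x mu)%E (fun p => k p * step (y z + l z * p.1) p.2)).
Proof.
by move=> hi ki; apply: (@integ_swap _ _ (@leb2 R) h k fst snd hi ki); [exact: measurable_fst|exact: measurable_snd].
Qed.

Lemma rint_swap1 (h k tau xi : R -> R) : integ mu h -> integ mu k ->
  measurable_fun setT tau -> measurable_fun setT xi ->
  rint mu (fun p => k p * rint mu (fun z => h z * step (y z + l z * tau p) (xi p))) =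
  rint mu (fun z => h z * rint mu (fun p => k p * step (y z + l z * tau p) (xi p))).
Proof. exact: (@rint_swap _ _ lebesgue_measure). Qed.

Lemma integ_swap1 (h k tau xi : R -> R) : integ mu h -> integ mu k ->
  measurable_fun setT tau -> measurable_fun setT xi ->
  integ mu (fun z => h z * rint mu (fun p => k p * step (y z + l z * tau p) (xi p))).
Proof. exact: (@integ_swap _ _ lebesgue_measure). Qed.

(** After the exchange of integrals [ray_dx] bounds each step, so the total mass of [|h|] serves as
    the constant. *)
Lemma xvar_superposition h w : integ mu h -> bmeas w ->
  (forall t x, 0 < t < T -> w t x = rint mu (fun z => h z * step (y z + l z * t) x)) ->
  xvar T w.
Proof.
move=> hi bw rw; exists (rint mu (fun z => `|h z|)) => phi a b c d cphi ab sphi phi1.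
have ki : integ (mu \x mu)%E (fun p => chi T c d p * dx phi p.1 p.2).
  by apply: integ_chi; [exact: meas_dx cphi|exact: bdd_dx cphi sphi].
have -> : rint (mu \x mu)%E (fun p => chi T c d p * (w p.1 p.2 * dx phi p.1 p.2)) =
    rint (mu \x mu)%E (fun p => (chi T c d p * dx phi p.1 p.2) *
    rint mu (fun z => h z * step (y z + l z * p.1) p.2)).
  apply: rint_ext => p.
  have [h0|h0] := pselect (0 < p.1 < T); last by rewrite chi_notin_time// !mul0r.
  by rewrite rw//; ring.
rewrite (rint_swap2 hi ki).
have sw := integ_swap2 hi ki.
apply: le_trans (rint_norm sw) _.
rewrite -(mulrC (b - a)) -rintZ; last exact: integ_norm.
apply: rint_le; [exact: integ_norm|by apply: integZ; exact: integ_norm|move=> z].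
rewrite normrM mulrC ler_wpM2r//.
have := ray_dx T (y z) (l z) cphi sphi ab phi1.
have -> // : rint (mu \x mu)%E (fun p => chi T c d p * (step (y z + l z * p.1) p.2 * dx phi p.1 p.2)) =
  rint (mu \x mu)%E (fun p => chi T c d p * dx phi p.1 p.2 * step (y z + l z * p.1) p.2).
by apply: rint_ext => p; ring.
Qed.

(** Once the integral in [z] is outermost, the time and space terms of each [z] combine into the
    weak identity of the single step with position [y z] and speed [l z]. *)
Lemma good_superposition w g : 0 < T -> bmeas w -> bmeas g ->
  (forall t x, 0 <= t < T -> w t x = rint mu (fun z => f z * step (y z + l z * t) x)) ->
  (forall t x, 0 <= t < T -> g t x = rint mu (fun z => f z * l z * step (y z + l z * t) x)) ->
  good T w g.
Proof.
move=> T0 bw bg rw rg; split; first by [].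
- move=> phi a b c d cphi bT sphi.
  have kx : integ (mu \x mu)%E (fun p => chi T c d p * dx phi p.1 p.2).
    by apply: integ_chi; [exact: meas_dx cphi|exact: bdd_dx cphi sphi].
  have kt : integ (mu \x mu)%E (fun p => chi T c d p * dt phi p.1 p.2).
    by apply: integ_chi; [exact: meas_dt cphi|exact: bdd_dt cphi sphi].
  have k0 : integ mu (fun x => \1_`[c, d] x * phi 0 x).
    by have := integ_init cphi sphi (bmeas_cst 1); apply: integ_ext => x; rewrite mul1r.
  have m3 : measurable_fun setT (fun _ : R => 0 : R) by exact: measurable_cst.
  have m4 : measurable_fun setT (fun x : R => x) by exact: measurable_id.
  rewrite (rint_weak_split T cphi sphi bw bg).
  transitivity (rint (mu \x mu)%E (fun p => (chi T c d p * dt phi p.1 p.2) *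
      rint mu (fun z => f z * step (y z + l z * p.1) p.2)) +
    rint (mu \x mu)%E (fun p => (chi T c d p * dx phi p.1 p.2) *
      rint mu (fun z => f z * l z * step (y z + l z * p.1) p.2))).
    congr (_ + _); apply: rint_ext => p; (have [h0|h0] := pselect (0 < p.1 < T);
      last by rewrite chi_notin_time// !mul0r).
      by rewrite rw; [ring|case/andP: h0 => /ltW -> ->].
    by rewrite rg; [ring|case/andP: h0 => /ltW -> ->].
  rewrite (rint_swap2 fi kt) (rint_swap2 fli kx).
  rewrite -(rintD (integ_swap2 fi kt) (integ_swap2 fli kx)).
  transitivity (- rint mu (fun x => (\1_`[c, d] x * phi 0 x) *
      rint mu (fun z => f z * step (y z + l z * 0) x))); last first.
    by congr (- _); apply: rint_ext => x; rewrite rw ?lexx ?T0//; ring.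
  rewrite (rint_swap1 fi k0 m3 m4) -mulN1r -rintZ; last exact: (integ_swap1 fi k0 m3 m4).
  apply: rint_ext => z.
  have := ray_weak (y z) (l z) cphi sphi T0 bT.
  rewrite (rint_ray_split T (y z) (l z) cphi sphi) mulr0 addr0.
  have -> : rint (mu \x mu)%E (fun p => chi T c d p * (step (y z + l z * p.1) p.2 * dt phi p.1 p.2)) =
     rint (mu \x mu)%E (fun p => chi T c d p * dt phi p.1 p.2 * step (y z + l z * p.1) p.2).
    by apply: rint_ext => p; ring.
  have -> : rint (mu \x mu)%E (fun p => chi T c d p * (step (y z + l z * p.1) p.2 * dx phi p.1 p.2)) =
     rint (mu \x mu)%E (fun p => chi T c d p * dx phi p.1 p.2 * step (y z + l z * p.1) p.2).
    by apply: rint_ext => p; ring.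
  have -> : rint mu (fun x => \1_`[c, d] x * (step (y z) x * phi 0 x)) =
     rint mu (fun x => \1_`[c, d] x * phi 0 x * step (y z) x) by apply: rint_ext => p; ring.
  by move=> E; rewrite mulrCA mulN1r -E; ring.
- by split; [apply: (xvar_superposition fi bw)|apply: (xvar_superposition fli bg)] => t x /andP[/ltW t0 tT];
    [apply: rw|apply: rg]; rewrite t0.
Qed.

Lemma balanced_superposition p q w g : 0 < T -> p <= q ->
  (forall z, f z != 0 -> noncross T p q (y z) (l z)) ->
  (forall t x, 0 <= t < T -> w t x = rint mu (fun z => f z * step (y z + l z * t) x)) ->
  (forall t x, 0 <= t < T -> g t x = rint mu (fun z => f z * l z * step (y z + l z * t) x)) ->
  balanced T p q w g.
Proof.
move=> T0 pq nc rw rg t tT.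
have T00 : 0 <= (0 : R) < T by apply/andP; split; lra.
have k0 := integ_itv p q.
have mc (r : R) : measurable_fun setT (fun _ : R => r) by exact: measurable_cst.
have m4 : measurable_fun setT (fun x : R => x) by exact: measurable_id.
have sw (r : R) : 0 <= r < T -> rint mu (fun x => \1_`[p, q] x * w r x) =
    rint mu (fun z => f z * rint mu (fun x => \1_`[p, q] x * step (y z + l z * r) x)).
  move=> rT; rewrite -(rint_swap1 fi k0 (mc r) m4).
  by apply: rint_ext => x; rewrite rw.
have isw (r : R) := integ_swap1 fi k0 (mc r) m4.
have il (r : R) : integ mu (fun z => f z * l z * step (y z + l z * 0) r).
  apply: integ_mul => //; last exact: bdd_step.
  by apply: meas_step => //; apply: measurable_funD => //; exact: measurable_funM.
rewrite sw// sw// !rg//.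
have E : t * (rint mu (fun z => f z * l z * step (y z + l z * 0) p) -
   rint mu (fun z => f z * l z * step (y z + l z * 0) q)) =
   rint mu (fun z => t * (f z * l z * step (y z + l z * 0) p) + (- t) * (f z * l z * step (y z + l z * 0) q)).
  rewrite rintD; [|exact: integZ|exact: integZ].
  by rewrite !rintZ//; ring.
rewrite E -rintD//; last by apply: integD; exact: integZ.
(* Steps of zero weight may cross the endpoints; they contribute nothing to either side. *)
apply: rint_ext => z; have [->|fz] := eqVneq (f z) 0; first by rewrite !mul0r; ring.
by rewrite (rint_step_balance pq (nc _ fz) tT) mulr0 addr0; ring.
Qed.

End superposition.

Lemma balancedD T p q w1 g1 w2 g2 : bmeas w1 -> bmeas w2 ->
  balanced T p q w1 g1 -> balanced T p q w2 g2 ->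
  balanced T p q (fun t x => w1 t x + w2 t x) (fun t x => g1 t x + g2 t x).
Proof.
move=> b1 b2 h1 h2 t tT.
rewrite (rintD_ext (integ_bmeas t b1 (integ_itv p q)) (integ_bmeas t b2 (integ_itv p q))); last by move=> x; ring.
rewrite [X in _ = X + _](rintD_ext (integ_bmeas 0 b1 (integ_itv p q)) (integ_bmeas 0 b2 (integ_itv p q))); last by move=> x; ring.
by rewrite h1// h2//; ring.
Qed.

Lemma balanced_cst T p q k k' : balanced T p q (fun _ _ => k) (fun _ _ => k').
Proof. by move=> t tT; rewrite subrr mulr0 addr0. Qed.

Lemma balanced_ray T p q k y s : p <= q -> noncross T p q y s ->
  balanced T p q (fun t x => k * step (y + s * t) x) (fun t x => s * k * step (y + s * t) x).
Proof.
move=> pq nc t tT; have bs := bmeas_step y s.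
rewrite (rintZ_ext (c := k) (integ_bmeas t bs (integ_itv p q))); last by move=> x; ring.
rewrite [X in _ = X + _](rintZ_ext (c := k) (integ_bmeas 0 bs (integ_itv p q))); last by move=> x; ring.
by rewrite (rint_step_balance pq nc tT) mulr0 addr0; ring.
Qed.

Lemma strip_chi (T c d : R) (k : R -> R -> R) :
  measurable_fun setT (fun p : R * R => k p.1 p.2) -> bdd (fun p : R * R => k p.1 p.2) ->
  (forall t x, ~ c <= x <= d -> k t x = 0) ->
  (\int[(mu \x mu)%E]_(p in strip T) (k p.1 p.2)%:E)%E =
  (rint (mu \x mu)%E (fun p => chi T c d p * k p.1 p.2))%:E.
Proof.
move=> mk bk k0.
have E : (fun p : R * R => \1_(strip T) p * k p.1 p.2) = (fun p => chi T c d p * k p.1 p.2).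
  apply/funext => -[t x]; rewrite /chi /=.
  have [h|h] := pselect (c <= x <= d); last by rewrite k0// !mulr0.
  rewrite (in_indic_itv h) mulr1; congr (_ * _); rewrite !indicE; congr (_%:R).
have mS : measurable (strip T : set (measurableTypeR R * measurableTypeR R)).
  rewrite (_ : strip T = (`]0, T[ `*` setT)%classic); first by apply: measurableX.
  by apply/seteqP; split => [[t x]|[t x] []]; rewrite /strip /= in_itv.
rewrite (@int_set _ _ _ (@leb2 R) (strip T) (fun p => k p.1 p.2) mS).
  by rewrite E !rintE.
by rewrite E; exact: integ_chi.
Qed.

Lemma good_weak_eq T w g : good T w g -> weak_eq T w g (w 0).
Proof.
move=> [[bw bg] W _] phi a b c d cphi bT sphi.
rewrite (@strip_chi T c d (fun t x => w t x * dt phi t x + g t x * dx phi t x)).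
- have -> : (\int[mu]_x (w 0 x * phi 0 x)%:E = (rint mu (fun x => \1_`[c, d] x * (w 0 x * phi 0 x)))%:E)%E.
    rewrite rint_EFin; last exact: (integ_init cphi sphi).
    apply: eq_integral => x _; have [h|h] := pselect (c <= x <= d); first by rewrite in_indic_itv// mul1r.
    by rewrite sphi ?mulr0// => -[].
  by rewrite (W _ _ _ _ _ cphi bT sphi) -EFinD addNr.
- case: bw bg => mw _ [mg _]; apply: measurable_funD; apply: measurable_funM => //;
    [exact: meas_dt cphi|exact: meas_dx cphi].
- case: bw bg => _ bw [_ bg]; apply: bddD; apply: bddM => //;
    [exact: bdd_dt cphi sphi|exact: bdd_dx cphi sphi].
- by move=> t x h; rewrite (supp_dt sphi) ?(supp_dx sphi) ?mulr0 ?addr0// => -[].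
Qed.

(** The [psi2] part is the variation of [w] in space. By the weak equation tested with [psi1], the
    [psi1] part is minus the integral of [g * dx psi1], bounded by the variation of [g] in space;
    the initial term vanishes because [a > 0]. *)
Lemma good_BVloc T w g : good T w g -> BVloc T w.
Proof.
move=> [[bw bg] W [[M xw] [N xg]]] a b c d a0 ab bT cd.
exists ((N + M) * (b - a)) => psi1 psi2 c1 c2 s1 s2 psi_le1.
have n1 t x : `|psi1 t x| <= 1.
  rewrite -(@ler_pXn2r _ 2)// ?nnegrE// expr1n real_normK ?num_real//.
  by have := psi_le1 t x; have := sqr_ge0 (psi2 t x); lra.
have n2 t x : `|psi2 t x| <= 1.
  rewrite -(@ler_pXn2r _ 2)// ?nnegrE// expr1n real_normK ?num_real//.
  by have := psi_le1 t x; have := sqr_ge0 (psi1 t x); lra.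
pose B : set (measurableTypeR R * measurableTypeR R) := (`]a, b[ `*` `]c, d[)%classic.
have mB : measurable B by exact: measurableX.
pose k (p : R * R) := w p.1 p.2 * dt psi1 p.1 p.2 + w p.1 p.2 * dx psi2 p.1 p.2.
have mk : measurable_fun setT k.
  by case: bw => mw _; apply: measurable_funD; apply: measurable_funM => //;
    [exact: meas_dt c1|exact: meas_dx c2].
have bk : bdd k.
  by case: bw => _ bw; apply: bddD; apply: bddM => //; [exact: bdd_dt c1 s1|exact: bdd_dx c2 s2].
have BE (p : R * R) : \1_B p = \1_`]a, b[ p.1 * \1_`]c, d[ p.2 :> R.
    case: p => t x /=.
    rewrite !indicE -natrM mulnb; congr (_%:R); congr nat_of_bool; apply/idP/idP.
      by rewrite !inE => -[] /= ? ?; apply/andP; rewrite !inE.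
    by case/andP; rewrite !inE.
have ik : integ (@leb2 R) (fun p => \1_B p * k p).
  have := integ_w (integ_itvoo a b) (integ_itvoo c d) mk bk.
  by apply: integ_ext => p; rewrite BE.
have -> : [set p : R * R | a < p.1 < b /\ c < p.2 < d] = B.
  by apply/seteqP; split => -[t x]; rewrite /B /= !in_itv.
have -> : (\int[(mu \x mu)%E]_(p in B) (w p.1 p.2 * (dt psi1 p.1 p.2 + dx psi2 p.1 p.2))%:E =
   \int[@leb2 R]_(p in B) (k p)%:E)%E.
  by apply: eq_integral => p _; rewrite /k mulrDr.
rewrite (int_set mB ik) lee_fin.
have k0 t x : ~ (a <= t <= b) \/ ~ (c <= x <= d) -> k (t, x) = 0.
  by move=> h; rewrite /k /= (supp_dt s1) ?(supp_dx s2) ?mulr0 ?addr0//; case: h => h [].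
(* Each open side is closed at no cost. Then [[a, b]], which lies inside []0, T[], is enlarged to
   it, as [k] vanishes at the other times. *)
have -> : rint (@leb2 R) (fun p => \1_B p * k p) = rint (mu \x mu)%E (fun p => chi T c d p * k p).
  transitivity (rint (mu \x mu)%E (fun p => \1_`]a, b[ p.1 * \1_`]c, d[ p.2 * k p)).
    by rewrite [LHS]rintE [RHS]rintE; congr fine; apply: eq_integral => p _; rewrite BE.
  rewrite (fubini_w1 (integ_itvoo a b) (integ_itvoo c d) mk bk).
  transitivity (rint mu (fun t => \1_`]a, b[ t * rint mu (fun x => \1_`[c, d] x * k (t, x)))).
    apply: rint_ext => t; congr (_ * _); apply: rint_oo_cc; first exact: meas_section1.
    exact: (bdd_comp (pair t) bk).
  rewrite -(fubini_w1 (integ_itvoo a b) (integ_itv c d) mk bk) (fubini_w2 (integ_itvoo a b) (integ_itv c d) mk bk).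
  transitivity (rint mu (fun x => \1_`[c, d] x * rint mu (fun t => \1_`[a, b] t * k (t, x)))).
    apply: rint_ext => x; congr (_ * _); apply: rint_oo_cc; first exact: meas_section2.
    exact: (bdd_comp (fun t => (t, x)) bk).
  rewrite -(fubini_w2 (integ_itv a b) (integ_itv c d) mk bk).
  apply: rint_ext => -[t x]; rewrite /chi /=.
  have [/andP[h1 h2]|h] := pselect (a <= t <= b); last by rewrite k0 ?mulr0//; left.
  rewrite in_indic_itv ?h1// in_indic_itvoo//; apply/andP; split; lra.
have bw1 := integ_dt T c1 s1 bw; have bw2 := integ_dx T c2 s2 bw.
rewrite (rintD_ext bw1 bw2); last by move=> p; rewrite /k; ring.
have := W _ _ _ _ _ c1 bT s1; rewrite (rint_weak_split T c1 s1 bw bg).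
have -> : rint mu (fun x => \1_`[c, d] x * (w 0 x * psi1 0 x)) = 0.
  rewrite (rintZ_ext (c := 0) (integ_itv c d)) ?mul0r// => x.
  by rewrite s1 ?mulr0 ?mul0r// => -[/andP[+ _] _]; apply/negP; rewrite -ltNge.
have := xg _ _ _ _ _ c1 ab s1 n1; have := xw _ _ _ _ _ c2 ab s2 n2.
by rewrite !ler_norml => /andP[? ?] /andP[? ?] ?; lra.
Qed.

(** Measurability is required at all times, and the denominator of the fan coordinate may vanish
    outside [[0, T)]. *)
Lemma meas_inv : measurable_fun setT (@GRing.inv R).
Proof.
rewrite -(setUv [set 0 : R]); apply/measurable_funU => //; first exact: measurableC.
split; first exact: measurable_fun_set1.
apply: open_continuous_measurable_fun.
  by rewrite openC; exact: closed_eq.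
by move=> x; rewrite inE /= => /eqP x0; exact: inv_continuous.
Qed.

Definition clamp (z0 z1 z : R) : R := Num.max z0 (Num.min z1 z).

Lemma clamp_in z0 z1 z : z0 <= z1 -> z0 <= clamp z0 z1 z <= z1.
Proof.
by move=> z01; rewrite /clamp le_max lexx ge_max z01 ge_min lexx.
Qed.

Lemma cont_clamp z0 z1 : continuous (clamp z0 z1).
Proof.
move=> z; apply: (@continuous_max _ _ (cst z0) (fun r => Num.min z1 r)); first exact: cvg_cst.
by apply: (@continuous_min _ _ (cst z1) id); [exact: cvg_cst|exact: cvg_id].
Qed.

(** * Fans with affine positions and affine speeds *)

Section fan.
Variables (T z0 z1 y0 b0 l0 l1 : R).
Hypotheses (z01 : z0 <= z1) (B0 : forall t, 0 <= t < T -> 0 < b0 + l1 * t).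

(** The solution [z] of [y0 + b0 * z + (l0 + l1 * z) * t = x], that is, the label of the
    characteristic through [(t, x)]. Clamping extends it by the edge labels on both sides of the
    fan; [B0] says that the fan does not focus before [T]. *)
Definition fan_coord (t x : R) : R := clamp z0 z1 ((x - y0 - l0 * t) / (b0 + l1 * t)).

Lemma fan_coord_in t x : z0 <= fan_coord t x <= z1.
Proof. exact: clamp_in. Qed.

Lemma meas_fan_coord : meas2 fan_coord.
Proof.
apply: (measurableT_comp (continuous_measurable_fun (@cont_clamp z0 z1))).
apply: measurable_funM.
  by apply: measurable_funB; [exact: measurable_funB|exact: measurable_funM].
apply: (measurableT_comp meas_inv).
by apply: measurable_funD => //; exact: measurable_funM.
Qed.

Lemma bmeas_fan (F : R -> R) : (forall z, z0 <= z <= z1 -> {for z, continuous F}) ->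
  bmeas (fun t x => F (fan_coord t x)).
Proof.
move=> cF; split.
  rewrite /meas2 (_ : (fun p : R * R => F (fan_coord p.1 p.2)) =
    (fun z => F (clamp z0 z1 z)) \o (fun p => (fan_coord p.1 p.2))); last first.
    by apply/funext => p /=; have := fan_coord_in p.1 p.2; rewrite /clamp => /andP[h1 h2]; rewrite min_r// max_r.
  apply: measurableT_comp; last exact: meas_fan_coord.
  apply: continuous_measurable_fun => z.
  by apply: continuous_comp; [exact: cont_clamp|apply: cF; exact: clamp_in].
have /compact_bounded[M [_ hM]] : compact (F @` `[z0, z1]).
  apply: continuous_compact; last exact: segment_compact.
  by apply: continuous_in_subspaceT => z; rewrite inE /= in_itv => h; exact: cF.
exists (`|M| + 1) => p; apply: hM; first by rewrite (le_lt_trans (ler_norm M))// ltrDl.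
by exists (fan_coord p.1 p.2) => //=; rewrite in_itv /=; exact: fan_coord_in.
Qed.

(** The step of label [z] has passed [x] exactly when [z] is at most the unclamped coordinate [th],
    so the right-hand side integrates [f] from [z0] up to the clamped coordinate: the fundamental
    theorem of calculus. *)
Lemma fan_rep (F f : R -> R) t x : 0 <= t < T ->
  (forall z, z0 <= z <= z1 -> is_derive z 1 F (f z)) -> {within `[z0, z1], continuous f} ->
  F (fan_coord t x) - F z0 =
  rint mu (fun z => \1_`[z0, z1] z * f z * step (y0 + b0 * z + (l0 + l1 * z) * t) x).
Proof.
move=> tT dF cf; have B := B0 tT; set th := (x - y0 - l0 * t) / (b0 + l1 * t).
have stepE z : step (y0 + b0 * z + (l0 + l1 * z) * t) x = if z <= th then 1 else 0.
  rewrite /step /th ler_pdivlMr//; congr (if _ then _ else _).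
  by apply/idP/idP => ?; lra.
rewrite /fan_coord -/th /clamp; have [h|h] := ltP th z0.
  rewrite max_l ?ge_min ?(ltW h) ?orbT// subrr.
  rewrite (rintZ_ext (c := 0) (integ_itv z0 z1)) ?mul0r// => z; rewrite mul0r stepE.
  case: ifP => hz; last by rewrite mulr0.
  by rewrite notin_indic_itv ?mul0r// => /andP[? ?]; lra.
set m := Num.min z1 th.
have m0 : z0 <= m by rewrite /m le_min z01.
have m1 : m <= z1 by rewrite /m ge_min lexx.
have m2 : m <= th by rewrite /m ge_min lexx orbT.
have cm : {within `[z0, m], continuous f}.
  by apply: continuous_subspaceW cf; apply: subset_itvl; rewrite bnd_simp.
have dm z : z0 <= z <= m -> is_derive z 1 F (f z).
  by move=> /andP[? ?]; apply: dF; apply/andP; split; lra.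
rewrite max_r// -(rint_FTC m0 cm dm).
apply: rint_ext => z; rewrite stepE.
have [/andP[h1 h2]|h1] := pselect (z0 <= z <= z1); last first.
  rewrite (notin_indic_itv h1) !mul0r notin_indic_itv ?mul0r// => /andP[h2 h3]; apply: h1.
  by apply/andP; split; lra.
rewrite (in_indic_itv (p := z0) (q := z1)) ?h1// mul1r; case: ifPn => hz.
  by rewrite in_indic_itv ?mulr1 ?mul1r// h1 /m le_min h2.
rewrite mulr0 notin_indic_itv ?mul0r// => /andP[_ h3]; move: hz; rewrite -ltNge; lra.
Qed.

Section fan_good.
Variables (F G f : R -> R).
Hypotheses (T0 : 0 < T) (dF : forall z, z0 <= z <= z1 -> is_derive z 1 F (f z))
  (dG : forall z, z0 <= z <= z1 -> is_derive z 1 G ((l0 + l1 * z) * f z))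
  (cf : {within `[z0, z1], continuous f}).

Let w t x := F (fan_coord t x) - F z0.
Let g t x := G (fan_coord t x) - G z0.

Let cont_der (H h : R -> R) : (forall z, z0 <= z <= z1 -> is_derive z 1 H (h z)) ->
  forall z, z0 <= z <= z1 -> {for z, continuous H}.
Proof. by move=> dH z /dH [/derivable1_diffP/differentiable_continuous]. Qed.

Let bw : bmeas w.
Proof. by apply: bmeasD; [apply: bmeas_fan; exact: cont_der dF|exact: bmeas_cst]. Qed.

Let bg : bmeas g.
Proof. by apply: bmeasD; [apply: bmeas_fan; exact: cont_der dG|exact: bmeas_cst]. Qed.

Let clf : {within `[z0, z1], continuous (fun z => (l0 + l1 * z) * f z)}.
Proof.
move=> z; apply: cvgM; last exact: cf.
have : continuous (fun z : R => l0 + l1 * z).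
  by move=> r; apply: cvgD; [exact: cvg_cst|apply: cvgM; [exact: cvg_cst|exact: cvg_id]].
by move=> /(@continuous_subspaceT _ _ `[z0, z1]); exact.
Qed.

Let fi : integ mu (fun z => \1_`[z0, z1] z * f z).
Proof.
apply: (iffLR (@integ_set _ _ _ mu `[z0, z1]%classic f (measurable_itv _))).
by apply: continuous_compact_integrable => //; exact: segment_compact.
Qed.

Let fli : integ mu (fun z => \1_`[z0, z1] z * f z * (l0 + l1 * z)).
Proof.
have : integ mu (fun z => \1_`[z0, z1] z * ((l0 + l1 * z) * f z)).
  apply: (iffLR (@integ_set _ _ _ mu `[z0, z1]%classic (fun z => (l0 + l1 * z) * f z) (measurable_itv _))).
  by apply: continuous_compact_integrable => //; exact: segment_compact.
by apply: integ_ext => z; ring.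
Qed.

Let my : measurable_fun setT (fun z => y0 + b0 * z).
Proof. by apply: measurable_funD => //; exact: measurable_funM. Qed.

Let ml : measurable_fun setT (fun z => l0 + l1 * z).
Proof. by apply: measurable_funD => //; exact: measurable_funM. Qed.

Let rw t x : 0 <= t < T -> w t x =
  rint mu (fun z => \1_`[z0, z1] z * f z * step (y0 + b0 * z + (l0 + l1 * z) * t) x).
Proof. by move=> tT; exact: fan_rep. Qed.

Let rg t x : 0 <= t < T -> g t x =
  rint mu (fun z => \1_`[z0, z1] z * f z * (l0 + l1 * z) * step (y0 + b0 * z + (l0 + l1 * z) * t) x).
Proof.
move=> tT; rewrite /g (fan_rep _ tT dG clf); apply: rint_ext => z; ring.
Qed.

Lemma good_fan : good T w g.
Proof. exact: (good_superposition fi fli my ml T0 bw bg rw rg). Qed.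

Lemma balanced_fan p q : p <= q ->
  (forall z, z0 <= z <= z1 -> noncross T p q (y0 + b0 * z) (l0 + l1 * z)) ->
  balanced T p q w g.
Proof.
move=> pq nc; apply: (balanced_superposition fi fli my ml T0 pq _ rw rg) => z fz; apply: nc.
have [//|h] := pselect (z0 <= z <= z1).
by rewrite notin_indic_itv ?mul0r ?eqxx in fz.
Qed.

End fan_good.
End fan.
End real_line.

(** * Derivative rules *)

Section derivatives.
Variable R : realType.
Implicit Types (f g : R -> R) (x a b : R).

(** The rules below produce unsimplified derivatives; this lemma leaves their comparison with the
    expected value to [ring] or [field]. *)
Lemma isder_eq f x a b : is_derive x 1 f a -> a = b -> is_derive x 1 f b.
Proof. by move=> ? <-. Qed.

Lemma isder_cst (c x : R) : is_derive x 1 (fun _ : R => c) 0.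
Proof. exact: is_derive_cst. Qed.

Lemma isder_id x : is_derive x 1 (fun y : R => y) 1.
Proof. exact: is_derive_id. Qed.

Lemma isder_add f g x a b : is_derive x 1 f a -> is_derive x 1 g b ->
  is_derive x 1 (fun y => f y + g y) (a + b).
Proof. by move=> df dg; apply: is_deriveD. Qed.

Lemma isder_opp f x a : is_derive x 1 f a -> is_derive x 1 (fun y => - f y) (- a).
Proof. by move=> df; apply: is_deriveN. Qed.

Lemma isder_mul f g x a b : is_derive x 1 f a -> is_derive x 1 g b ->
  is_derive x 1 (fun y => f y * g y) (a * g x + f x * b).
Proof. by move=> df dg; apply: (isder_eq (is_deriveM df dg)); rewrite /GRing.scale /=; ring. Qed.

Lemma isder_inv f x a : f x != 0 -> is_derive x 1 f a ->
  is_derive x 1 (fun y => (f y)^-1) (- a / f x ^+ 2).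
Proof. by move=> f0 df; apply: (isder_eq (is_deriveV f0 df)); rewrite /GRing.scale /= -exprVn; ring. Qed.

Lemma isder_ln f x a : 0 < f x -> is_derive x 1 f a -> is_derive x 1 (fun y => ln (f y)) (a / f x).
Proof.
move=> f0 df; have dl := is_derive1_ln f0.
by apply: (isder_eq (@is_derive1_comp _ (@ln R) f x _ _ dl df)); rewrite mulrC.
Qed.

Lemma isder_affine (c0 c1 x : R) : is_derive x 1 (fun y => c0 + c1 * y) c1.
Proof.
apply: (isder_eq (isder_add (isder_cst c0 x) (isder_mul (isder_cst c1 x) (isder_id x)))); ring.
Qed.

End derivatives.

(** * Relative entropy and simple waves *)

Section gas.
Variables (R : realType) (gamma : R).
Implicit Types (u w : state R).

Definition prim (r v e : R) : state R := mkstate r (r * v) (r * (v ^+ 2 / 2 + e)).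

Lemma rho_prim r v e : rho (prim r v e) = r. Proof. by []. Qed.

Lemma vel_prim r v e : r != 0 -> vel (prim r v e) = v.
Proof. by move=> r0; rewrite /vel /prim /mkstate /mom /rho /=; field. Qed.

Lemma eint_prim r v e : r != 0 -> eint (prim r v e) = e.
Proof. by move=> r0; rewrite /eint /prim /mkstate /energy /mom /rho /=; field. Qed.

Lemma prim_state w : rho w != 0 -> w = prim (rho w) (vel w) (eint w).
Proof.
case: w => [[r q] E] r0; rewrite /rho /= in r0.
by rewrite /prim /mkstate /vel /eint /rho /mom /energy /=; congr (_, _, _); field.
Qed.

(** Up to normalisation, minus the physical entropy per unit mass; simple waves keep it constant. *)
Definition sentropy (w : state R) : R := (gamma - 1) * ln (rho w) - ln (eint w).

Lemma entropyE w : entropy gamma w = rho w * sentropy w.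
Proof. by rewrite /entropy /sentropy; ring. Qed.

(** The partial derivative of the entropy in [rho]; the other components of the gradient are
    [vel w / eint w] and [- (eint w)^-1]. *)
Definition eta_r (w : state R) : R := sentropy w + gamma - vel w ^+ 2 / (2 * eint w).

(** Apart from [entropy gamma u], the right-hand side is affine in the conserved variables of [u].
    This is what later gives the relative entropy a flux along the solution. *)
Lemma rel_entropyE u w : admissible w -> rel_entropy gamma u w =
  entropy gamma u - entropy gamma w - (eta_r w * (rho u - rho w)
    + vel w / eint w * (mom u - mom w) - (eint w)^-1 * (energy u - energy w)).
Proof.
move=> [r0 e0]; rewrite /rel_entropy; congr (_ - _); rewrite derive1E.
set r1 := rho u - rho w; set q1 := mom u - mom w; set E1 := energy u - energy w.
pose r s := rho w + r1 * s; pose q s := mom w + q1 * s; pose E s := energy w + E1 * s.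
pose e s := E s * (r s)^-1 - q s * q s * (2 * (r s * r s))^-1.
have -> : (fun s : R => entropy gamma (sadd w (sscale s (ssub u w)))) =
    (fun s => (gamma - 1) * (r s * ln (r s)) - r s * ln (e s)).
  apply/funext => s; rewrite /entropy.
  have -> : rho (sadd w (sscale s (ssub u w))) = r s by rewrite /r /r1 /ssub /sadd /sscale /sadd /mkstate /rho /=; ring.
  have -> : eint (sadd w (sscale s (ssub u w))) = e s.
    rewrite /eint /e; have -> : rho (sadd w (sscale s (ssub u w))) = r s by rewrite /r /r1 /ssub /sadd /sscale /sadd /mkstate /rho /=; ring.
    have -> : mom (sadd w (sscale s (ssub u w))) = q s by rewrite /q /q1 /ssub /sadd /sscale /sadd /mkstate /mom /=; ring.
    have -> : energy (sadd w (sscale s (ssub u w))) = E s by rewrite /E /E1 /ssub /sadd /sscale /sadd /mkstate /energy /=; ring.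
    by rewrite -!expr2.
  by ring.
have dr : is_derive (0 : R) 1 r r1 := isder_affine (rho w) r1 0.
have dq : is_derive (0 : R) 1 q q1 := isder_affine (mom w) q1 0.
have dE : is_derive (0 : R) 1 E E1 := isder_affine (energy w) E1 0.
have r00 : r 0 = rho w by rewrite /r mulr0 addr0.
have q00 : q 0 = mom w by rewrite /q mulr0 addr0.
have E00 : E 0 = energy w by rewrite /E mulr0 addr0.
have e00 : e 0 = eint w by rewrite /e r00 q00 E00 /eint -!expr2.
have rn : r 0 != 0 by rewrite r00 gt_eqF.
have r2n : 2 * (r 0 * r 0) != 0 by rewrite !mulf_neq0// pnatr_eq0.
have de := isder_add (isder_mul dE (isder_inv rn dr))
  (isder_opp (isder_mul (isder_mul dq dq) (@isder_inv _ (fun s => 2 * (r s * r s)) _ _ r2n (isder_mul (isder_cst 2 0) (isder_mul dr dr))))).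
have rp : 0 < r 0 by rewrite r00.
have ep : 0 < e 0 by rewrite e00.
have dS := isder_add (isder_mul (isder_cst (gamma - 1) 0) (isder_mul dr (@isder_ln _ r _ _ rp dr)))
  (isder_opp (isder_mul dr (@isder_ln _ e _ _ ep de))).
have [_ ->] := dS.
rewrite -/(r 0) -/(q 0) -/(E 0) -/(e 0) e00 r00 q00 E00 /eta_r /sentropy.
move: (prim_state (w := w)); rewrite gt_eqF// => /(_ isT) wE.
have -> : mom w = rho w * vel w by rewrite {1}wE.
have -> : energy w = rho w * (vel w ^+ 2 / 2 + eint w) by rewrite {1}wE.
by field; rewrite !gt_eqF.
Qed.

End gas.

(** * The simple wave through a base state and its conserved pairs *)

Section wave.
Variables (R : realType) (gamma sigma rb k : R).
Hypotheses (g1 : 1 < gamma) (rb0 : 0 < rb) (k0 : k != 0).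

(* [k] is plus or minus the sound speed of the base state, the sign selecting the wave family. *)
Definition gexp : R := 2 / (gamma - 1).
Definition eb : R := k ^+ 2 / (gamma * (gamma - 1)).
Definition rr (x : R) : R := expR (gexp * ln x).
Definition vv (x : R) : R := sigma + gexp * k + - (gexp * k) * x.
(** [x] is the sound speed divided by that of the base: the base is at [x = 1] and vacuum is
    approached as [x] decreases to 0. Constant entropy forces the power [gexp] in the density, and
    constancy of the Riemann invariant [v + gexp * k * x] gives [vv]. *)
Definition wave (x : R) : state R := prim (rb * rr x) (vv x) (eb * x ^+ 2).
(** [lam0 + lam1 * x] is the characteristic speed [vv x - k * x]: the first family for [k > 0], the
    third for [k < 0]. *)
Definition lam0 : R := sigma + gexp * k.
Definition lam1 : R := - ((gexp + 1) * k).
(* The derivative of [rr], a factor of the derivative of every conserved quantity along the wave. *)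
Definition mm (x : R) : R := gexp * rr x / x.

Lemma gm0 : gamma - 1 != 0. Proof. by rewrite gt_eqF// subr_gt0. Qed.
Lemma gam0 : gamma != 0. Proof. by rewrite gt_eqF// (lt_trans ltr01). Qed.
Lemma gexp_gt0 : 0 < gexp. Proof. by rewrite divr_gt0// subr_gt0. Qed.
Lemma eb_gt0 : 0 < eb.
Proof. by rewrite divr_gt0 ?exprn_even_gt0//= mulr_gt0 ?subr_gt0// (lt_trans ltr01). Qed.
Lemma rr_gt0 x : 0 < rr x. Proof. exact: expR_gt0. Qed.
Lemma rr1 : rr 1 = 1. Proof. by rewrite /rr ln1 mulr0 expR0. Qed.
Lemma vv1 : vv 1 = sigma. Proof. by rewrite /vv; ring. Qed.

Lemma wave_rho_gt0 x : 0 < rho (wave x).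
Proof. by rewrite rho_prim mulr_gt0// rr_gt0. Qed.

Lemma vel_wave x : vel (wave x) = vv x.
Proof. by rewrite vel_prim// gt_eqF// mulr_gt0// rr_gt0. Qed.

Lemma eint_wave x : eint (wave x) = eb * x ^+ 2.
Proof. by rewrite eint_prim// gt_eqF// mulr_gt0// rr_gt0. Qed.

Lemma wave1 : wave 1 = prim rb sigma eb.
Proof. by rewrite /wave rr1 vv1 expr1n !mulr1. Qed.

(** The powers of [x] in density and internal energy cancel because [(gamma - 1) * gexp = 2]. *)
Lemma sentropy_wave (x : R) : 0 < x -> sentropy gamma (wave x) = sentropy gamma (wave 1).
Proof.
move=> x0; rewrite /sentropy !eint_wave /wave !rho_prim.
have L y : 0 < y -> ln (rb * rr y) = ln rb + gexp * ln y.
  by move=> y0; rewrite lnM ?posrE ?rr_gt0// /rr expRK.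
have E y : 0 < y -> ln (eb * y ^+ 2) = ln eb + (ln y + ln y).
  by move=> y0; have e0 := eb_gt0; move: eb e0 => e e0; rewrite lnM ?posrE ?exprn_gt0// lnXn.
rewrite !L// !E// ln1 /gexp; move: (ln eb) => e.
by field; exact: gm0.
Qed.

Lemma isder_rr (x : R) : 0 < x -> is_derive x 1 rr (mm x).
Proof.
move=> x0.
have d1 := isder_mul (isder_cst gexp x) (@isder_ln R (fun y => y) x 1 x0 (isder_id x)).
apply: (isder_eq (@is_derive1_comp _ expR _ x _ _ (is_derive_expR _) d1)).
by rewrite /mm /rr /=; ring.
Qed.

Lemma isder_vv (x : R) : is_derive x 1 vv (- (gexp * k)).
Proof. exact: isder_affine. Qed.

Lemma isder_sq (x : R) : is_derive x 1 (fun y : R => y ^+ 2) (2 * x).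
Proof.
rewrite (_ : (fun y : R => y ^+ 2) = fun y => y * y); last by apply/funext => y; rewrite expr2.
by apply: (isder_eq (isder_mul (isder_id x) (isder_id x))); ring.
Qed.

Variables (ul ur : state R).

(** What makes [f(u)] conserved with flux [g(u)] along the constructed solution: Rankine-Hugoniot
    with speed [sigma] at the two contacts, and [g' = lambda * f'] along the wave. The condition is
    linear in the pair, so relative entropies follow from mass, momentum, energy and entropy. *)
Definition cons_pair (f g : state R -> R) : Prop :=
  [/\ g (wave 1) - g ul = sigma * (f (wave 1) - f ul),
      g ur - g (wave 1) = sigma * (f ur - f (wave 1)) &
      exists P : R -> R, continuous P /\ forall x : R, 0 < x ->
        is_derive x 1 (fun y => f (wave y)) (mm x * P x) /\
        is_derive x 1 (fun y => g (wave y)) ((lam0 + lam1 * x) * (mm x * P x))].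

Lemma cons_pairD f1 g1' f2 g2 : cons_pair f1 g1' -> cons_pair f2 g2 ->
  cons_pair (fun w => f1 w + f2 w) (fun w => g1' w + g2 w).
Proof.
move=> [a1 b1 [P1 [c1 d1]]] [a2 b2 [P2 [c2 d2]]]; split.
- by rewrite opprD addrACA a1 a2; ring.
- by rewrite opprD addrACA b1 b2; ring.
- exists (fun x => P1 x + P2 x); split; first by move=> x; apply: cvgD; [exact: c1|exact: c2].
  move=> x x0; have [e1 e1'] := d1 x x0; have [e2 e2'] := d2 x x0; split.
    by apply: (isder_eq (isder_add e1 e2)); ring.
  by apply: (isder_eq (isder_add e1' e2')); ring.
Qed.

Lemma cons_pairZ c f1 g1' : cons_pair f1 g1' -> cons_pair (fun w => c * f1 w) (fun w => c * g1' w).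
Proof.
move=> [a1 b1 [P1 [c1 d1]]]; split.
- by rewrite -mulrBr a1; ring.
- by rewrite -mulrBr b1; ring.
- exists (fun x => c * P1 x); split; first by move=> x; apply: cvgM; [exact: cvg_cst|exact: c1].
  move=> x x0; have [e1 e1'] := d1 x x0; split.
    by apply: (isder_eq (isder_mul (isder_cst c x) e1)); ring.
  by apply: (isder_eq (isder_mul (isder_cst c x) e1')); ring.
Qed.

Lemma cons_pair_cst c : cons_pair (fun _ => c) (fun _ => 0).
Proof.
split; try by ring.
exists (fun=> 0); split; first by move=> x; exact: cvg_cst.
by move=> x x0; rewrite !mulr0; split; exact: isder_cst.
Qed.

Hypotheses (hul : admissible ul) (hur : admissible ur).
Hypotheses (vul : vel ul = sigma) (vur : vel ur = sigma).
Hypotheses (pl : pres gamma ul = pres gamma (prim rb sigma eb))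
  (pr : pres gamma ur = pres gamma (prim rb sigma eb)).

(** At velocity [sigma] and the common pressure every flux is [sigma] times its density plus a
    constant shared by the three states; subtraction gives Rankine-Hugoniot. *)
Let contact (w : state R) : Prop :=
  [/\ rho (flux gamma w) = sigma * rho w,
      mom (flux gamma w) = sigma * mom w + pres gamma (prim rb sigma eb),
      energy (flux gamma w) = sigma * energy w + sigma * pres gamma (prim rb sigma eb) &
      entropy_flux gamma w = sigma * entropy gamma w].

Let contactP w : rho w != 0 -> vel w = sigma -> pres gamma w = pres gamma (prim rb sigma eb) -> contact w.
Proof.
move=> r0 vw pw; split.
- by rewrite /flux /mkstate /= -vw /vel; rewrite /rho /=; field.
- by rewrite /flux /mkstate {1}/mom /= vw pw; ring.
- by rewrite /flux /mkstate {1}/energy /= vw pw; ring.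
- by rewrite /entropy_flux vw mulrC.
Qed.

Let cl : contact ul. Proof. by apply: contactP => //; rewrite gt_eqF; case: hul. Qed.
Let cr : contact ur. Proof. by apply: contactP => //; rewrite gt_eqF; case: hur. Qed.
Let cb : contact (wave 1).
Proof. by rewrite wave1; apply: contactP; rewrite ?vel_prim ?rho_prim// gt_eqF. Qed.

Let cont_affine (c0 c1 : R) : continuous (fun x : R => c0 + c1 * x).
Proof. by move=> x; apply: cvgD; [exact: cvg_cst|apply: cvgM; [exact: cvg_cst|exact: cvg_id]]. Qed.


Lemma cons_pair_rho : cons_pair (@rho R) (fun w => rho (flux gamma w)).
Proof.
case: cl => l1 _ _ _; case: cr => r1 _ _ _; case: cb => b1 _ _ _; split.
- by rewrite b1 l1; ring.
- by rewrite r1 b1; ring.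
- exists (fun=> rb); split; first by move=> x; exact: cvg_cst.
  move=> x x0; have xn : x != 0 by rewrite gt_eqF.
  split; first by apply: (isder_eq (isder_mul (isder_cst rb x) (isder_rr x0))); ring.
  apply: (isder_eq (isder_mul (isder_mul (isder_cst rb x) (isder_rr x0)) (isder_vv x))).
  by rewrite /lam0 /lam1 /mm /vv; field.
Qed.

Lemma cons_pair_mom : cons_pair (@mom R) (fun w => mom (flux gamma w)).
Proof.
case: cl => _ l1 _ _; case: cr => _ r1 _ _; case: cb => _ b1 _ _; split.
- by rewrite b1 l1; ring.
- by rewrite r1 b1; ring.
- exists (fun x => rb * (lam0 + lam1 * x)); split.
    by move=> x; apply: cvgM; [exact: cvg_cst|exact: cont_affine].
  move=> x x0; have xn : x != 0 by rewrite gt_eqF.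
  have dq := isder_mul (isder_mul (isder_cst rb x) (isder_rr x0)) (isder_vv x).
  split; first by apply: (isder_eq dq); rewrite /lam0 /lam1 /mm /vv; field.
  have -> : (fun y => mom (flux gamma (wave y))) =
      (fun y => rb * rr y * vv y * vv y + (gamma - 1) * (rb * rr y * (eb * y ^+ 2))).
    apply/funext => y; rewrite /flux /mkstate {1}/mom /= /pres vel_wave eint_wave /wave /prim /mkstate /mom /rho /=.
    by ring.
  apply: (isder_eq (isder_add (isder_mul dq (isder_vv x)) (isder_mul (isder_cst (gamma - 1) x)
    (isder_mul (isder_mul (isder_cst rb x) (isder_rr x0)) (isder_mul (isder_cst eb x) (isder_sq x)))))).
  rewrite /lam0 /lam1 /mm /vv /eb /gexp; field; by rewrite xn gam0 gm0.
Qed.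

Lemma cons_pair_energy : cons_pair (@energy R) (fun w => energy (flux gamma w)).
Proof.
case: cl => _ _ l1 _; case: cr => _ _ r1 _; case: cb => _ _ b1 _; split.
- by rewrite b1 l1; ring.
- by rewrite r1 b1; ring.
(* The derivative of the energy divided by [mm x], after substituting [rr x = mm x * x / gexp]; the
   term in [k ^+ 2] is the specific enthalpy [gamma * e]. *)
- exists (fun x => rb * (vv x * vv x / 2 + - k * (vv x * x) + k ^+ 2 / (gamma - 1) * (x * x))); split.
    have cv : continuous vv by exact: cont_affine.
    move=> x.
    apply: cvgM; first exact: cvg_cst.
    apply: cvgD; last by apply: cvgM; [exact: cvg_cst|apply: cvgM; exact: cvg_id].
    apply: cvgD; last by apply: cvgM; [exact: cvg_cst|apply: cvgM; [exact: cv|exact: cvg_id]].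
    by apply: cvgM; [apply: cvgM; exact: cv|exact: cvg_cst].
  move=> x x0; have xn : x != 0 by rewrite gt_eqF.
  have dr := isder_mul (isder_cst rb x) (isder_rr x0).
  have dE := isder_mul dr (isder_add (isder_mul (isder_mul (isder_vv x) (isder_vv x)) (isder_cst 2^-1 x))
    (isder_mul (isder_cst eb x) (isder_sq x))).
  split.
    have -> : (fun y => energy (wave y)) =
        (fun y => rb * rr y * (vv y * vv y * 2^-1 + eb * y ^+ 2)).
      by apply/funext => y; rewrite /wave /prim /mkstate /energy /= expr2.
    by apply: (isder_eq dE); rewrite /mm /vv /eb /gexp; field; rewrite xn gam0 gm0.
  have -> : (fun y => energy (flux gamma (wave y))) =
      (fun y => (rb * rr y * (vv y * vv y * 2^-1 + eb * y ^+ 2) + (gamma - 1) * (rb * rr y * (eb * y ^+ 2))) * vv y).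
    apply/funext => y; rewrite /flux /mkstate {1}/energy /= /pres vel_wave eint_wave /wave /prim /mkstate /energy /rho /=.
    by ring.
  apply: (isder_eq (isder_mul (isder_add dE (isder_mul (isder_cst (gamma - 1) x)
    (isder_mul dr (isder_mul (isder_cst eb x) (isder_sq x))))) (isder_vv x))).
  by rewrite /lam0 /lam1 /mm /vv /eb /gexp; field; rewrite xn gam0 gm0.
Qed.

(** Along the wave [sentropy] is constant, so entropy and entropy flux are the same constant
    multiple of mass and mass flux. *)
Lemma cons_pair_entropy : cons_pair (entropy gamma) (entropy_flux gamma).
Proof.
case: cl => _ _ _ l1; case: cr => _ _ _ r1; case: cb => _ _ _ b1; split.
- by rewrite b1 l1; ring.
- by rewrite r1 b1; ring.
- have [_ _ [P [cP dP]]] := cons_pairZ (sentropy gamma (wave 1)) cons_pair_rho.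
  exists P; split; first exact: cP.
  move=> x x0; have [d1 d2] := dP x x0.
  have nx : \near x, 0 < x by exact: lt_nbhsr.
  split; [apply: near_eq_is_derive d1|apply: near_eq_is_derive d2]; near=> y;
    (have y0 : 0 < y by near: y).
    by rewrite entropyE sentropy_wave// mulrC.
  rewrite /entropy_flux entropyE sentropy_wave// vel_wave /flux /mkstate {1}/rho /= /wave /prim /mkstate /mom /rho /=.
  by ring.
Unshelve. all: by end_near. Qed.

(** The flux of the relative entropy up to a constant depending on [w], which disappears in the
    differences where it is used. *)
Definition rel_flux (w u : state R) : R :=
  entropy_flux gamma u - (eta_r gamma w * rho (flux gamma u)
    + vel w / eint w * mom (flux gamma u) - (eint w)^-1 * energy (flux gamma u)).

Lemma cons_pair_rel w : admissible w -> cons_pair (fun u => rel_entropy gamma u w) (rel_flux w).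
Proof.
move=> hw.
have H := cons_pairD (cons_pairD (cons_pairD cons_pair_entropy
  (cons_pairD (cons_pairZ (- eta_r gamma w) cons_pair_rho) (cons_pairZ (- (vel w / eint w)) cons_pair_mom)))
  (cons_pairZ (eint w)^-1 cons_pair_energy))
  (cons_pair_cst (- entropy gamma w + eta_r gamma w * rho w + vel w / eint w * mom w - (eint w)^-1 * energy w)).
move: H; congr cons_pair; apply/funext => u; first by rewrite rel_entropyE//; ring.
by rewrite /rel_flux; ring.
Qed.

End wave.

(** * Relative entropy and its flux with respect to a state moving at speed [sigma] *)

Section relative.
Variables (R : realType) (gamma sigma : R).
Hypothesis g1 : 1 < gamma.
Implicit Types u w : state R.

(** This form isolates [(gamma - 1) * rho w], the value that remains when [u] tends to vacuum. *)
Lemma rel_entropy_rest u w : admissible w -> vel w = sigma -> rho u != 0 ->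
  rel_entropy gamma u w = rho u * (sentropy gamma u - sentropy gamma w - gamma
    + (eint u + (vel u - sigma) ^+ 2 / 2) / eint w) + (gamma - 1) * rho w.
Proof.
move=> hw vw ru; rewrite rel_entropyE// !entropyE /eta_r.
have rw : rho w != 0 by case: hw => /lt0r_neq0.
have ew : eint w != 0 by case: hw => _ /lt0r_neq0.
have -> : mom w = rho w * vel w by rewrite {1}(prim_state rw).
have -> : energy w = rho w * (vel w ^+ 2 / 2 + eint w) by rewrite {1}(prim_state rw).
have -> : mom u = rho u * vel u by rewrite {1}(prim_state ru).
have -> : energy u = rho u * (vel u ^+ 2 / 2 + eint u) by rewrite {1}(prim_state ru).
by rewrite vw; field.
Qed.

(** Splits the flux into transport of the relative entropy and work of the pressure. In [growth] the
    transport part is proportional to [relgap], so only the work survives at a zero of [relgap]. *)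
Lemma rel_flux_rest u w : admissible w -> vel w = sigma -> rho u != 0 ->
  rel_flux gamma w u - rel_flux gamma w w =
  vel u * rel_entropy gamma u w + (vel u - sigma) * (pres gamma u - pres gamma w) / eint w.
Proof.
move=> hw vw ru; rewrite rel_entropyE// /rel_flux /entropy_flux !entropyE /eta_r.
have rw : rho w != 0 by case: hw => /lt0r_neq0.
have ew : eint w != 0 by case: hw => _ /lt0r_neq0.
have fE z : rho z != 0 -> flux gamma z = mkstate (rho z * vel z) (rho z * vel z * vel z + pres gamma z)
    (rho z * (vel z ^+ 2 / 2 + eint z) * vel z + pres gamma z * vel z).
  by move=> rz; rewrite /flux; congr mkstate; rewrite {1}(prim_state rz).
rewrite (fE _ ru) (fE _ rw) /mkstate.
have -> : mom w = rho w * vel w by rewrite {1}(prim_state rw).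
have -> : energy w = rho w * (vel w ^+ 2 / 2 + eint w) by rewrite {1}(prim_state rw).
have -> : mom u = rho u * vel u by rewrite {1}(prim_state ru).
have -> : energy u = rho u * (vel u ^+ 2 / 2 + eint u) by rewrite {1}(prim_state ru).
have sU (x y z : R) : rho (x, y, z) = x by [].
have sM (x y z : R) : mom (x, y, z) = y by [].
have sE (x y z : R) : energy (x, y, z) = z by [].
by rewrite !sU !sM !sE /pres vw; field.
Qed.

Lemma rel_entropy_self w : admissible w -> rel_entropy gamma w w = 0.
Proof. by move=> hw; rewrite rel_entropyE//; ring. Qed.

(** With equal velocities and pressures and [X = eint u / eint w], the relative entropy equals
    [gamma * rho u * (X - 1 - ln X)], positive for [X] different from 1. *)
Lemma rel_entropy_contact u w : admissible u -> admissible w ->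
  vel u = sigma -> vel w = sigma -> pres gamma u = pres gamma w -> eint u != eint w ->
  0 < rel_entropy gamma u w.
Proof.
move=> [ru eu] [rw ew] vu vw; rewrite /pres -!mulrA => /(mulfI (gm0 g1)) p ne.
rewrite rel_entropy_rest//; last by rewrite gt_eqF.
pose X := eint u / eint w.
have X0 : 0 < X by rewrite divr_gt0.
have rE : rho w = rho u * X by rewrite /X mulrA p; field; rewrite gt_eqF.
have -> : sentropy gamma u - sentropy gamma w = - (gamma * ln X).
  rewrite /sentropy rE lnM ?posrE// /X lnM ?posrE ?invr_gt0// lnV ?posrE//; ring.
have X1 : ln X != 0.
  rewrite ln_eq0//; apply: contra_neq ne => X1; apply/eqP.
  by rewrite -[eint u](divfK (lt0r_neq0 ew)) -/X X1 mul1r.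
have := expR_gt1Dx X1; rewrite lnK ?posrE// => lX.
rewrite rE vu subrr expr0n /= mul0r addr0 -/X.
rewrite (_ : _ + _ = rho u * gamma * (X - (1 + ln X))); last by ring.
by rewrite !mulr_gt0 ?subr_gt0// (lt_trans ltr01).
Qed.

End relative.

(** * Choice of the base state, the wave family and the plateau *)

Section choice.
Variables (R : realType) (gamma sigma : R) (ul ur : state R) (a : R).
Hypotheses (g1 : 1 < gamma) (hl : admissible ul) (hr : admissible ur).
Hypotheses (vl : vel ul = sigma) (vr : vel ur = sigma).
Hypotheses (p : pres gamma ul = pres gamma ur) (ne : eint ul != eint ur) (a0 : 0 < a).

Definition relgap (w : state R) : R := rel_entropy gamma w ul - a * rel_entropy gamma w ur.

(** The rate [D]: the net relative entropy flux into each half-line through the plateau and the far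
    end, the right one weighted by [a]. *)
Definition growth (w : state R) : R :=
  - (rel_flux gamma ul w - rel_flux gamma ul ul) + a * (rel_flux gamma ur w - rel_flux gamma ur ur).

Lemma wave_root rb k : 0 < rb -> k != 0 ->
  pres gamma ul = pres gamma (prim rb sigma (eb gamma k)) ->
  ((gamma - 1) * (rho ul - a * rho ur)) * relgap (wave gamma sigma rb k 1) < 0 ->
  exists2 x : R, 0 < x < 1 & relgap (wave gamma sigma rb k x) = 0.
Proof.
move=> rb0 k0 pl; set C := (gamma - 1) * _; set W := wave gamma sigma rb k => CG.
have pr : pres gamma ur = pres gamma (prim rb sigma (eb gamma k)) by rewrite -p.
have eb0 := eb_gt0 g1 k0.
have C0 : C != 0 by apply: contraTN CG => /eqP ->; rewrite mul0r ltxx.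
pose D w := sentropy gamma (W 1) - sentropy gamma w - gamma.
pose Q x := eb gamma k * x ^+ 2 + (vv gamma sigma k x - sigma) ^+ 2 / 2.
have GE x : 0 < x -> relgap (W x) =
    rb * rr gamma x * (D ul + Q x / eint ul - a * (D ur + Q x / eint ur)) + C.
  move=> x0; have Wr : rho (W x) != 0 by rewrite gt_eqF// wave_rho_gt0.
  rewrite /relgap (rel_entropy_rest _ hl vl Wr) (rel_entropy_rest _ hr vr Wr).
  rewrite sentropy_wave// (vel_wave _ _ _ rb0) (eint_wave _ _ _ rb0) /C /D /Q.
  by rewrite /W /wave rho_prim -/(wave gamma sigma rb k 1); ring.
(* Bounds the bracket of [GE] on [(0, 1]]: there [Q] is at most its terms with [x ^+ 2] and
   [(1 - x) ^+ 2] replaced by 1. *)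
pose N : R := `|D ul| + a * `|D ur| + (eb gamma k + (gexp gamma * k) ^+ 2 / 2) * ((eint ul)^-1 + a / eint ur).
have el0 : 0 < (eint ul)^-1 by rewrite invr_gt0; case: hl.
have er0 : 0 < (eint ur)^-1 by rewrite invr_gt0; case: hr.
have QN x : 0 < x <= 1 -> 0 <= Q x <= eb gamma k + (gexp gamma * k) ^+ 2 / 2.
  move=> /andP[x0 x1].
  have vE : vv gamma sigma k x - sigma = (1 - x) * (gexp gamma * k) by rewrite /vv; ring.
  have s1 : 0 <= x ^+ 2 <= 1 by rewrite sqr_ge0 /= expr_le1// ltW.
  have s2 : 0 <= (1 - x) ^+ 2 <= 1.
    by rewrite sqr_ge0 /= expr_le1// ?subr_ge0// lerBlDr lerDl ltW.
  rewrite /Q vE exprMn; have := sqr_ge0 (gexp gamma * k); move: (_ ^+ 2) => q q0.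
  case/andP: s1 => s10 s11; case/andP: s2 => s20 s21.
  have := mulr_ge0 (ltW eb0) s10; have := ler_wpM2l (ltW eb0) s11.
  have := mulr_ge0 s20 q0; have := ler_wpM2r q0 s21; rewrite mulr1 mul1r => ? ? ? ?.
  by apply/andP; split; lra.
have BN x : 0 < x <= 1 -> `|D ul + Q x / eint ul - a * (D ur + Q x / eint ur)| <= N.
  move=> /QN /andP[q0 q1].
  rewrite (_ : _ - _ = D ul - a * D ur + (Q x / eint ul - a * (Q x / eint ur))); last by ring.
  have h1 : 0 <= Q x / eint ul by rewrite mulr_ge0// ltW.
  have h2 : 0 <= a * (Q x / eint ur) by rewrite !mulr_ge0// ltW.
  apply: le_trans (ler_normD _ _) _; rewrite /N lerD//.
    by apply: le_trans (ler_normB _ _) _; rewrite normrM (gtr0_norm a0).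
  apply: le_trans (ler_normB _ _) _; rewrite !ger0_norm//.
  rewrite (_ : _ + _ = Q x * ((eint ul)^-1 + a / eint ur)); last by ring.
  by rewrite ler_wpM2r// addr_ge0 ?(ltW el0)// mulr_ge0// ltW.
have N0 : 0 <= N by apply: le_trans (BN 1 _); rewrite ?normr_ge0// ltr01 lexx.
have nC : 0 < `|C| by rewrite normr_gt0.
(* At [x0 = expR (- M)] one has [rr = expR (- gexp * M)] with [gexp * M = rb * N / |C|]. As
   [expR y >= 1 + y], this makes [rb * N * rr] smaller than [|C|], so [relgap] has the sign of [C]
   there. *)
pose M : R := rb * N / (`|C| * gexp gamma).
have gx := gexp_gt0 g1.
have M0 : 0 <= M by apply: divr_ge0; apply: mulr_ge0 => //; exact: ltW.
pose x0 := expR (- M).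
have x00 : 0 < x0 by exact: expR_gt0.
have x01 : x0 <= 1 by rewrite /x0 -expR0 ler_expR oppr_le0.
have small : `|rb * rr gamma x0 * (D ul + Q x0 / eint ul - a * (D ur + Q x0 / eint ur))| < `|C|.
  have rr0 := rr_gt0 gamma x0.
  rewrite normrM gtr0_norm ?mulr_gt0//.
  apply: (@le_lt_trans _ _ (rb * N * rr gamma x0)).
    rewrite [leRHS]mulrAC; apply: ler_wpM2l; first by rewrite mulr_ge0 ?ltW.
    by apply: BN; rewrite x00.
  have rE : rr gamma x0 = (expR (gexp gamma * M))^-1.
    by rewrite /rr /x0 expRK mulrN expRN.
  have : 1 + gexp gamma * M <= expR (gexp gamma * M) by exact: expR_ge1Dx.
  have -> : gexp gamma * M = rb * N / `|C| by rewrite /M; field; rewrite !gt_eqF.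
  move=> h; rewrite rE -/(_ / _) ltr_pdivrMr ?expR_gt0//.
  rewrite (_ : gexp gamma * M = rb * N / `|C|); last by rewrite /M; field; rewrite !gt_eqF.
  apply: lt_le_trans (_ : `|C| * (1 + rb * N / `|C|) <= _); last by rewrite ler_wpM2l.
  have -> : `|C| * (1 + rb * N / `|C|) = `|C| + rb * N by field; rewrite gt_eqF.
  by rewrite ltrDr.
have cW x : 0 < x -> {for x, continuous (fun y => relgap (W y))}.
  move=> xp.
  have [_ _ [P1 [_ d1]]] := cons_pair_rel g1 rb0 k0 hl hr vl vr pl pr hl.
  have [_ _ [P2 [_ d2]]] := cons_pair_rel g1 rb0 k0 hl hr vl vr pl pr hr.
  have [e1 _] := d1 _ xp; have [e2 _] := d2 _ xp.
  have [dd _] := isder_add e1 (isder_opp (isder_mul (isder_cst a x) e2)).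
  by move: dd => /derivable1_diffP/differentiable_continuous.
have sgn : Num.min (relgap (W x0)) (relgap (W 1)) <= 0 <= Num.max (relgap (W x0)) (relgap (W 1)).
  move: CG small; rewrite (GE _ x00); set B := rb * rr gamma x0 * _; rewrite ge_min le_max.
  have [Cp|Cn|/eqP] := ltgtP C 0; last by rewrite (negbTE C0).
    rewrite (nmulr_rlt0 _ Cp) (ltr0_norm Cp) ltr_norml => G1 /andP[b1 b2].
    by apply/andP; split; apply/orP; [left|right]; lra.
  rewrite (pmulr_rlt0 _ Cn) (gtr0_norm Cn) ltr_norml => G1 /andP[b1 b2].
  by apply/andP; split; apply/orP; [right|left]; lra.
have cw : {within `[x0, 1], continuous (fun y => relgap (W y))}.
  apply: continuous_in_subspaceT => x; rewrite inE /= in_itv /= => /andP[h _].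
  by apply: cW; apply: lt_le_trans h.
have [x] := IVT x01 cw sgn; rewrite in_itv /= => /andP[h1 h2] Gx.
exists x => //; rewrite (lt_le_trans x00 h1) lt_neqAle h2 andbT.
(* The root is not at 1, since the hypothesis excludes a zero of [relgap] there. *)
by apply: contraTneq CG => x1; rewrite -x1 -/W Gx mulr0 ltxx.
Qed.

(** For [x < 1] the velocity excess has the sign of [k] and the pressure has dropped, so the work
    term has the sign of [- k * (a / e_r - 1 / e_l)]. *)
Lemma growth_wave rb k x : 0 < rb -> k != 0 ->
  pres gamma ul = pres gamma (prim rb sigma (eb gamma k)) ->
  0 < x < 1 -> relgap (wave gamma sigma rb k x) = 0 ->
  k * (a / eint ur - (eint ul)^-1) < 0 -> 0 < growth (wave gamma sigma rb k x).
Proof.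
move=> rb0 k0 pl /andP[x0 x1] G0 kk; set u := wave _ _ _ _ _.
have ur0 : rho u != 0 by rewrite gt_eqF// wave_rho_gt0.
rewrite /growth (rel_flux_rest _ hl vl ur0) (rel_flux_rest _ hr vr ur0).
have -> : - (vel u * rel_entropy gamma u ul + (vel u - sigma) * (pres gamma u - pres gamma ul) / eint ul) +
   a * (vel u * rel_entropy gamma u ur + (vel u - sigma) * (pres gamma u - pres gamma ur) / eint ur) =
   - (vel u * relgap u) + (vel u - sigma) * (pres gamma u - pres gamma ul) * (a / eint ur - (eint ul)^-1).
  by rewrite /relgap -p; ring.
rewrite G0 mulr0 oppr0 add0r.
have eb0 := eb_gt0 g1 k0; have gx := gexp_gt0 g1.
have -> : vel u - sigma = gexp gamma * (1 - x) * k.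
  by rewrite /u (vel_wave _ _ _ rb0) /vv; ring.
have -> : pres gamma u - pres gamma ul = - ((gamma - 1) * rb * eb gamma k * (1 - rr gamma x * x ^+ 2)).
  rewrite pl /pres eint_prim ?gt_eqF// /u (eint_wave _ _ _ rb0) /wave !rho_prim; ring.
have r1 : rr gamma x < 1.
  by rewrite /rr -expR0 ltr_expR pmulr_rlt0// ln_lt0// x0.
have x21 : x ^+ 2 < 1 by rewrite expr_lt1// ltW.
have rx : rr gamma x * x ^+ 2 < 1.
  apply: (@le_lt_trans _ _ (rr gamma x * 1)); last by rewrite mulr1.
  by rewrite ler_wpM2l ?ltW// rr_gt0.
rewrite (_ : _ * _ * _ = gexp gamma * (1 - x) * ((gamma - 1) * rb * eb gamma k * (1 - rr gamma x * x ^+ 2)) *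
   - (k * (a / eint ur - (eint ul)^-1))); last by ring.
apply: mulr_gt0; last by rewrite oppr_gt0.
apply: mulr_gt0; first by apply: mulr_gt0 => //; rewrite subr_gt0.
apply: mulr_gt0; last by rewrite subr_gt0.
by apply: mulr_gt0 => //; apply: mulr_gt0 => //; rewrite subr_gt0.
Qed.

Lemma exists_wave : a / eint ur != (eint ul)^-1 ->
  exists rb k x : R, [/\ 0 < rb /\ k != 0, 0 < x < 1,
    pres gamma ul = pres gamma (prim rb sigma (eb gamma k)),
    relgap (wave gamma sigma rb k x) = 0 & 0 < growth (wave gamma sigma rb k x)].
Proof.
move=> an; have [rl el] := hl; have [rr_ er] := hr.
pose K := a / eint ur - (eint ul)^-1.
have K0 : K != 0 by rewrite subr_eq0.
have g10 : 0 < gamma - 1 by rewrite subr_gt0.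
have gg : 0 < gamma * (gamma - 1) by rewrite mulr_gt0// (lt_trans ltr01).
(* The gap is negative at [ul] and positive at [ur], while its vacuum limit [- K * p] has the sign
   of [- K]; this choice of base makes the two signs opposite. *)
pose b := if K < 0 then ul else ur.
have hb : admissible b by rewrite /b; case: ifP.
have vb : vel b = sigma by rewrite /b; case: ifP.
have pb : pres gamma ul = pres gamma b by rewrite /b; case: ifP.
have [rb0 eb0] := hb.
pose s := Num.sqrt (gamma * (gamma - 1) * eint b).
have s0 : 0 < s by rewrite sqrtr_gt0 mulr_gt0.
(* The sign of [k] is opposite to that of [K], which is the condition for positive growth. *)
pose k := if K < 0 then s else - s.
have k0 : k != 0 by rewrite /k; case: ifP => _; rewrite ?oppr_eq0 gt_eqF.
have k2 : k ^+ 2 = gamma * (gamma - 1) * eint b.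
  by rewrite /k; case: ifP => _; rewrite ?sqrrN sqr_sqrtr// mulr_ge0// ltW.
have ebE : eb gamma k = eint b by rewrite /eb k2 mulrAC mulfV ?mul1r// gt_eqF.
have bE : prim (rho b) sigma (eb gamma k) = b by rewrite ebE -vb -prim_state// gt_eqF.
have pbE : pres gamma ul = pres gamma (prim (rho b) sigma (eb gamma k)) by rewrite bE.
have CE : (gamma - 1) * (rho ul - a * rho ur) = - K * pres gamma ul.
  rewrite mulrBr (_ : (gamma - 1) * rho ul = pres gamma ul / eint ul); last by rewrite /pres; field; rewrite gt_eqF.
  rewrite (_ : (gamma - 1) * (a * rho ur) = a * (pres gamma ur / eint ur)); last by rewrite /pres; field; rewrite gt_eqF.
  by rewrite -p /K; ring.
have pp : 0 < pres gamma ul by rewrite /pres !mulr_gt0.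
have [x x01 Gx] : exists2 x : R, 0 < x < 1 & relgap (wave gamma sigma (rho b) k x) = 0.
  apply: wave_root => //; rewrite wave1 bE CE /relgap /b.
  have [Kn|Kp] := ltP K 0.
    have ent := rel_entropy_contact g1 hl hr vl vr p ne.
    rewrite rel_entropy_self// sub0r mulrN oppr_lt0.
    by apply: mulr_gt0; apply: mulr_gt0 => //; rewrite oppr_gt0.
  have Kp' : 0 < K by rewrite lt_neqAle eq_sym K0.
  have ent : 0 < rel_entropy gamma ur ul.
    by apply: (rel_entropy_contact g1 hr hl vr vl (esym p)); rewrite eq_sym.
  rewrite rel_entropy_self// mulr0 subr0 !mulNr oppr_lt0.
  by apply: mulr_gt0 => //; exact: mulr_gt0.
exists (rho b), k, x; split => //; apply: growth_wave => //.
rewrite -/K /k; have [Kn|Kp] := ltP K 0; first by rewrite pmulr_rlt0.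
by rewrite mulNr oppr_lt0 mulr_gt0// lt_neqAle eq_sym K0.
Qed.

End choice.

(** * The growing solution *)

Lemma weak_eq_ext (R : realType) (T : R) (w g w' g' : R -> R -> R) (w0 w0' : R -> R) :
  (forall t x, 0 <= t < T -> w t x = w' t x) -> (forall t x, 0 <= t < T -> g t x = g' t x) ->
  w0 =1 w0' -> weak_eq T w g w0 -> weak_eq T w' g' w0'.
Proof.
move=> ew eg /funext <- W phi a b c d cphi bT sphi; rewrite -(W phi a b c d cphi bT sphi).
congr (_ + _)%E; apply: eq_integral => p; rewrite inE /strip /= => /andP[p0 pT].
by rewrite ew ?eg// pT ltW.
Qed.

Lemma BVloc_ext (R : realType) (T : R) (w w' : R -> R -> R) :
  (forall t x, 0 <= t < T -> w t x = w' t x) -> BVloc T w -> BVloc T w'.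
Proof.
move=> ew bv a b c d a0 ab bT cd; have [M hM] := bv a b c d a0 ab bT cd.
exists M => psi1 psi2 c1 c2 s1 s2 le1; apply: le_trans (hM psi1 psi2 c1 c2 s1 s2 le1).
rewrite le_eqVlt; apply/orP; left; apply/eqP; apply: eq_integral => p.
rewrite inE /= => -[/andP[h1 h2] _]; rewrite ew//; apply/andP; split; lra.
Qed.

Lemma isder_comp_opp (R : realType) (f : R -> R) (z a : R) :
  is_derive (- z) 1 f a -> is_derive z 1 (fun y => f (- y)) (- a).
Proof.
move=> df; have dn := isder_opp (isder_id z).
by apply: (isder_eq (@is_derive1_comp _ f _ z _ _ df dn)); ring.
Qed.

Lemma fan_coord_left (R : realType) (z0 z1 y0 b0 l0 l1 t x : R) : z0 <= z1 -> 0 < b0 + l1 * t ->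
  x <= y0 + b0 * z0 + (l0 + l1 * z0) * t -> fan_coord z0 z1 y0 b0 l0 l1 t x = z0.
Proof.
move=> z01 B h; rewrite /fan_coord /clamp max_l// ge_min; apply/orP; right.
by rewrite ler_pdivrMr//; lra.
Qed.

Lemma fan_coord_right (R : realType) (z0 z1 y0 b0 l0 l1 t x : R) : z0 <= z1 -> 0 < b0 + l1 * t ->
  y0 + b0 * z1 + (l0 + l1 * z1) * t <= x -> fan_coord z0 z1 y0 b0 l0 l1 t x = z1.
Proof.
move=> z01 B h; rewrite /fan_coord /clamp min_l ?max_r//.
by rewrite ler_pdivlMr//; lra.
Qed.

Section solution.
Variables (R : realType) (gamma sigma rb k xb : R) (ul ur : state R).
Hypotheses (g1 : 1 < gamma) (rb0 : 0 < rb) (k0 : k != 0) (xb01 : 0 < xb < 1).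
Let mu := @lebesgue_measure R.
Let W := wave gamma sigma rb k.
Let l0 := lam0 gamma sigma k.
Let l1 := lam1 gamma k.
(** The inverse slope of the initial profile, giving each wave width 1 at time 0. *)
Let bw := (1 - xb)^-1.
Let V : R := `|l0| + `|l1| + `|sigma| + 1.

(** [V] dominates every speed in the solution, so up to this time no front moves by more than 1/4.
    As [|l1| * t <= 1/4 < bw], the compression does not focus either. *)
Definition lifespan : R := (4 * V)^-1.
Let T := lifespan.

(* The left wave is parametrised by [z = - x], so that both coordinates increase with the position. *)
Definition coordA : R -> R -> R := fan_coord (-1) (- xb) (-1 + xb * bw) bw l0 (- l1).
Definition coordB : R -> R -> R := fan_coord xb 1 (1 - xb * bw) bw l0 l1.

(** At time 0 the contacts sit at -3 and 3 and the waves occupy [[-2, -1]] and [[1, 2]]. Moves of at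
    most 1/4 keep the pieces disjoint and preserve the plateau on [[-3/4, 3/4]], inside which the
    cut at 0 lies. *)
Definition sol (t x : R) : state R :=
  if x < -3 + sigma * t then ul else
  if x < 0 then W (- coordA t x) else
  if x < 3 + sigma * t then W (coordB t x) else ur.

Let xb0 : 0 < xb. Proof. by case/andP: xb01. Qed.
Let xb1 : xb < 1. Proof. by case/andP: xb01. Qed.
Let V0 : 0 < V. Proof. by rewrite ltr_wpDl// !addr_ge0. Qed.

Lemma lifespan_gt0 : 0 < T.
Proof. by rewrite invr_gt0 mulr_gt0. Qed.

Let bwE : bw * (1 - xb) = 1.
Proof. by rewrite mulVf// gt_eqF// subr_gt0. Qed.

Let bw1 : 1 <= bw.
Proof. by rewrite invf_ge1 ?subr_gt0// lerBlDr lerDl ltW. Qed.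

Let spd (v t : R) : `|v| <= V -> 0 <= t < T -> -1/4 <= v * t <= 1/4.
Proof.
move=> vV /andP[t0 tT].
have h : `|v * t| <= 1/4.
  rewrite normrM (ger0_norm t0).
  apply: (@le_trans _ _ (V * T)); first by rewrite ler_pM// ltW.
  by rewrite /T /lifespan invfM mulrCA mulfV ?gt_eqF//; lra.
by move: h; rewrite ler_norml => /andP[? ?]; apply/andP; split; lra.
Qed.

Let spd_sigma (t : R) : 0 <= t < T -> -1/4 <= sigma * t <= 1/4.
Proof.
by apply: spd; rewrite /V; have := normr_ge0 l0; have := normr_ge0 l1; lra.
Qed.

Let spd_l1 (t : R) : 0 <= t < T -> -1/4 <= l1 * t <= 1/4.
Proof.
by apply: spd; rewrite /V; have := normr_ge0 l0; have := normr_ge0 sigma; lra.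
Qed.

Let spd_lam (x t : R) : xb <= x <= 1 -> 0 <= t < T -> -1/4 <= (l0 + l1 * x) * t <= 1/4.
Proof.
move=> /andP[x0 x1]; apply: spd; apply: le_trans (ler_normD _ _) _.
rewrite normrM /V; have : `|l1| * `|x| <= `|l1|.
  have xp : 0 <= x by exact: le_trans (ltW xb0) x0.
  by rewrite (ger0_norm xp) ler_piMr.
by have := normr_ge0 sigma; lra.
Qed.

Let BA (t : R) : 0 <= t < T -> 0 < bw + - l1 * t.
Proof. by have ? := bw1; move=> /spd_l1 /andP[? ?]; lra. Qed.

Let BB (t : R) : 0 <= t < T -> 0 < bw + l1 * t.
Proof. by have ? := bw1; move=> /spd_l1 /andP[? ?]; lra. Qed.

Let zA01 : -1 <= - xb. Proof. by rewrite lerN2 ltW. Qed.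
Let zB01 : xb <= 1. Proof. exact: ltW. Qed.

Let posA (z : R) : -1 <= z <= - xb -> -2 <= (-1 + xb * bw) + bw * z <= -1.
Proof.
move=> /andP[h1 h2]; have ? := bw1.
have e1 : bw * (z + xb) <= 0 by rewrite mulr_ge0_le0//; lra.
have e2 : 0 <= bw * (z + 1) by rewrite mulr_ge0//; lra.
by have := bwE => ?; apply/andP; split; lra.
Qed.

Let posB (z : R) : xb <= z <= 1 -> 1 <= (1 - xb * bw) + bw * z <= 2.
Proof.
move=> /andP[h1 h2]; have ? := bw1.
have e1 : bw * (z - 1) <= 0 by rewrite mulr_ge0_le0//; lra.
have e2 : 0 <= bw * (z - xb) by rewrite mulr_ge0//; lra.
by have := bwE => ?; apply/andP; split; lra.
Qed.

Let spdA (z t : R) : -1 <= z <= - xb -> 0 <= t < T -> -1/4 <= (l0 + - l1 * z) * t <= 1/4.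
Proof.
move=> /andP[h1 h2] tT; rewrite (_ : l0 + - l1 * z = l0 + l1 * - z); last by ring.
apply: spd_lam => //; apply/andP; split; lra.
Qed.

Let coordA_left (t x : R) : 0 <= t < T -> x <= -9/4 -> coordA t x = -1.
Proof.
move=> tT h; apply: fan_coord_left => //; first exact: BA.
have z1 : -1 <= (-1 : R) <= - xb by apply/andP; split; [lra|exact: zA01].
by have /andP[? ?] := posA z1; have /andP[? ?] := spdA z1 tT; lra.
Qed.

Let coordA_right (t x : R) : 0 <= t < T -> -3/4 <= x -> coordA t x = - xb.
Proof.
move=> tT h; apply: fan_coord_right => //; first exact: BA.
have z1 : -1 <= - xb <= - xb by apply/andP; split; [exact: zA01|lra].
by have /andP[? ?] := posA z1; have /andP[? ?] := spdA z1 tT; lra.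
Qed.

Let coordB_left (t x : R) : 0 <= t < T -> x <= 3/4 -> coordB t x = xb.
Proof.
move=> tT h; apply: fan_coord_left => //; first exact: BB.
have z1 : xb <= xb <= 1 by apply/andP; split; [lra|exact: zB01].
by have /andP[? ?] := posB z1; have /andP[? ?] := spd_lam z1 tT; lra.
Qed.

Let coordB_right (t x : R) : 0 <= t < T -> 9/4 <= x -> coordB t x = 1.
Proof.
move=> tT h; apply: fan_coord_right => //; first exact: BB.
have z1 : xb <= (1 : R) <= 1 by apply/andP; split; [exact: zB01|lra].
by have /andP[? ?] := posB z1; have /andP[? ?] := spd_lam z1 tT; lra.
Qed.

(** Away from its own fan or contact each increment is zero or complete, so the sum telescopes to
    [f (sol t x)]. The unreduced [- -1] is the left edge of the fan in the variable [z = - x]. *)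
Definition rep (f : state R -> R) (t x : R) : R :=
  f ul + (f (W 1) - f ul) * step (-3 + sigma * t) x
  + (f (W (- coordA t x)) - f (W (- -1)))
  + (f (W (coordB t x)) - f (W xb))
  + (f ur - f (W 1)) * step (3 + sigma * t) x.

Lemma sol_rep f (t x : R) : 0 <= t < T -> f (sol t x) = rep f t x.
Proof.
move=> tT; have /andP[s1 s2] := spd_sigma tT; rewrite /sol /rep /step.
have [h1|h1] := ltP x (-3 + sigma * t).
  rewrite coordA_left ?coordB_left//; [|lra|lra].
  rewrite (_ : 3 + sigma * t <= x = false); last by apply/negbTE; rewrite -ltNge; lra.
  by ring.
have [h2|h2] := ltP x 0.
  rewrite (coordB_left tT); last by lra.
  rewrite (_ : 3 + sigma * t <= x = false); last by apply/negbTE; rewrite -ltNge; lra.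
  by rewrite opprK; ring.
rewrite (coordA_right tT); last by lra.
have [h3|h3] := ltP x (3 + sigma * t); first by rewrite !opprK; ring.
by rewrite coordB_right//; [rewrite !opprK; ring|lra].
Qed.

Lemma sol_mid (t x : R) : 0 <= t < T -> -3/4 <= x <= 3/4 -> sol t x = W xb.
Proof.
move=> tT /andP[x1 x2]; have /andP[s1 s2] := spd_sigma tT; rewrite /sol.
rewrite ifF; last by apply/negbTE; rewrite -leNgt; lra.
case: ifP => _; first by rewrite coordA_right// opprK.
by rewrite ifT ?coordB_left//; lra.
Qed.

Lemma sol_left (t x : R) : 0 <= t < T -> x <= -4 -> sol t x = ul.
Proof. by move=> tT hx; have /andP[s1 s2] := spd_sigma tT; rewrite /sol ifT//; lra. Qed.

Lemma sol_right (t x : R) : 0 <= t < T -> 4 <= x -> sol t x = ur.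
Proof.
move=> tT hx; have /andP[s1 s2] := spd_sigma tT.
by rewrite /sol !ifF//; apply/negbTE; rewrite -leNgt; lra.
Qed.

Lemma sol_cases (t x : R) : [\/ sol t x = ul, sol t x = ur | exists2 z : R, xb <= z <= 1 & sol t x = W z].
Proof.
have hA := fan_coord_in (-1 + xb * bw) bw l0 (- l1) zA01 t x.
have hB := fan_coord_in (1 - xb * bw) bw l0 l1 zB01 t x.
rewrite /sol; case: ifP => _; first exact: Or31.
case: ifP => _.
  by apply: Or33; exists (- coordA t x) => //; move: hA; rewrite -/(coordA t x) => /andP[? ?]; apply/andP; split; lra.
by case: ifP => _; [apply: Or33; exists (coordB t x)|exact: Or32].
Qed.

Let cont_der (H : R -> R) (x a : R) : is_derive x 1 H a -> {for x, continuous H}.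
Proof. by move=> [/derivable1_diffP/differentiable_continuous]. Qed.

Lemma cont_mm (x : R) : 0 < x -> {for x, continuous (mm gamma)}.
Proof.
move=> x0; have xn : x != 0 by rewrite gt_eqF.
exact: cont_der (isder_mul (isder_mul (isder_cst (gexp gamma) x) (isder_rr _ x0)) (isder_inv xn (isder_id x))).
Qed.

Section pair.
Variables (f g : state R -> R).
Hypothesis fg : cons_pair gamma sigma rb k ul ur f g.

Lemma good_rep_fanB : good T (fun t x => f (W (coordB t x)) - f (W xb))
    (fun t x => g (W (coordB t x)) - g (W xb)) /\
  (forall p q, p <= q -> (forall z : R, xb <= z <= 1 -> noncross T p q (1 - xb * bw + bw * z) (l0 + l1 * z)) ->
    balanced T p q (fun t x => f (W (coordB t x)) - f (W xb)) (fun t x => g (W (coordB t x)) - g (W xb))).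
Proof.
case: fg => _ _ [P [cP dP]].
have dF (z : R) : xb <= z <= 1 -> is_derive z 1 (fun y => f (W y)) (mm gamma z * P z).
  by move=> /andP[z1 _]; have [] := dP z (lt_le_trans xb0 z1).
have dG (z : R) : xb <= z <= 1 -> is_derive z 1 (fun y => g (W y)) ((l0 + l1 * z) * (mm gamma z * P z)).
  by move=> /andP[z1 _]; have [] := dP z (lt_le_trans xb0 z1).
have cf : {within `[xb, 1], continuous (fun z => mm gamma z * P z)}.
  apply: continuous_in_subspaceT => z; rewrite inE /= in_itv /= => /andP[z1 _].
  by apply: cvgM; [apply: cont_mm; exact: lt_le_trans z1|exact: cP].
split; first exact: (good_fan (1 - xb * bw) zB01 BB lifespan_gt0 dF dG cf).
move=> p q pq nc.
exact: (balanced_fan zB01 BB lifespan_gt0 dF dG cf pq nc).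
Qed.

Lemma good_rep_fanA : good T (fun t x => f (W (- coordA t x)) - f (W (- -1)))
    (fun t x => g (W (- coordA t x)) - g (W (- -1))) /\
  (forall p q, p <= q -> (forall z : R, -1 <= z <= - xb -> noncross T p q (-1 + xb * bw + bw * z) (l0 + - l1 * z)) ->
    balanced T p q (fun t x => f (W (- coordA t x)) - f (W (- -1)))
    (fun t x => g (W (- coordA t x)) - g (W (- -1)))).
Proof.
case: fg => _ _ [P [cP dP]].
have pos (z : R) : -1 <= z <= - xb -> 0 < - z by have ? := xb0; move=> /andP[z1 z2]; lra.
have dF (z : R) : -1 <= z <= - xb -> is_derive z 1 (fun y => f (W (- y))) (- (mm gamma (- z) * P (- z))).
  by move=> /pos z0; have [d1 _] := dP _ z0; exact: isder_comp_opp.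
have dG (z : R) : -1 <= z <= - xb ->
    is_derive z 1 (fun y => g (W (- y))) ((l0 + - l1 * z) * - (mm gamma (- z) * P (- z))).
  move=> /pos z0; have [_ d1] := dP _ z0; apply: (isder_eq (isder_comp_opp d1)).
  by rewrite -/l0 -/l1; ring.
have cf : {within `[-1, - xb], continuous (fun z => - (mm gamma (- z) * P (- z)))}.
  apply: continuous_in_subspaceT => z; rewrite inE /= in_itv /= => /pos z0.
  apply: cvgN; apply: cvgM.
    by apply: (@continuous_comp _ _ _ -%R (mm gamma)); [exact: opp_continuous|exact: cont_mm].
  by apply: (@continuous_comp _ _ _ -%R P); [exact: opp_continuous|exact: cP].
split; first exact: (good_fan (-1 + xb * bw) zA01 BA lifespan_gt0 dF dG cf).
move=> p q pq nc.
exact: (balanced_fan zA01 BA lifespan_gt0 dF dG cf pq nc).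
Qed.

Let gray1 := good_ray (f (W 1) - f ul) (-3) sigma lifespan_gt0.
Let gray2 := good_ray (f ur - f (W 1)) 3 sigma lifespan_gt0.
Let gcst := good_cst (f ul) (g ul) lifespan_gt0.

(** Rankine-Hugoniot turns the flux jumps at the contacts into [sigma] times the jumps of [f], the
    form of a travelling step. *)
Let repg : rep g = fun t x => g ul + sigma * (f (W 1) - f ul) * step (-3 + sigma * t) x
  + (g (W (- coordA t x)) - g (W (- -1))) + (g (W (coordB t x)) - g (W xb))
  + sigma * (f ur - f (W 1)) * step (3 + sigma * t) x.
Proof.
case: fg => e1 e2 _; apply/funext => t; apply/funext => x.
by rewrite /rep -e1 -e2.
Qed.

Lemma good_rep : good T (rep f) (rep g).
Proof.
rewrite repg.
exact: (goodD (goodD (goodD (goodD gcst gray1) good_rep_fanA.1) good_rep_fanB.1) gray2).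
Qed.

Let balanced_rep p q : p <= q -> noncross T p q (-3) sigma -> noncross T p q 3 sigma ->
  (forall z : R, xb <= z <= 1 -> noncross T p q (1 - xb * bw + bw * z) (l0 + l1 * z)) ->
  (forall z : R, -1 <= z <= - xb -> noncross T p q (-1 + xb * bw + bw * z) (l0 + - l1 * z)) ->
  balanced T p q (rep f) (rep g).
Proof.
move=> pq n1 n2 nB nA; rewrite repg.
have [[bc _] _ _] := gcst; have [[b1 _] _ _] := gray1; have [[b2 _] _ _] := gray2.
have [[[bA _] _ _] hA] := good_rep_fanA; have [[[bB _] _ _] hB] := good_rep_fanB.
have B1 := balancedD bc b1 (@balanced_cst _ T p q (f ul) (g ul)) (balanced_ray (f (W 1) - f ul) pq n1).
have B2 := balancedD (bmeasD bc b1) bA B1 (hA _ _ pq nA).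
have B3 := balancedD (bmeasD (bmeasD bc b1) bA) bB B2 (hB _ _ pq nB).
exact: (balancedD (bmeasD (bmeasD (bmeasD bc b1) bA) bB) b2 B3 (balanced_ray (f ur - f (W 1)) pq n2)).
Qed.

(** Until [T] the left contact and the left wave remain inside [(-5, 0]], and everything else
    remains to the right of 0. *)
Lemma balanced_left : balanced T (-5) 0 (rep f) (rep g).
Proof.
apply: balanced_rep; first by lra.
- by apply: Or31 => t tT; have /andP[? ?] := spd_sigma tT; apply/andP; split; lra.
- by apply: Or32 => t tT; have /andP[? ?] := spd_sigma tT; lra.
- by move=> z hz; apply: Or32 => t tT; have /andP[? ?] := posB hz; have /andP[? ?] := spd_lam hz tT; lra.
- move=> z hz; apply: Or31 => t tT; have /andP[? ?] := posA hz; have /andP[? ?] := spdA hz tT.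
  by apply/andP; split; lra.
Qed.

Lemma balanced_right : balanced T 0 5 (rep f) (rep g).
Proof.
apply: balanced_rep; first by lra.
- by apply: Or33 => t tT; have /andP[? ?] := spd_sigma tT; lra.
- by apply: Or31 => t tT; have /andP[? ?] := spd_sigma tT; apply/andP; split; lra.
- move=> z hz; apply: Or31 => t tT; have /andP[? ?] := posB hz; have /andP[? ?] := spd_lam hz tT.
  by apply/andP; split; lra.
- by move=> z hz; apply: Or33 => t tT; have /andP[? ?] := posA hz; have /andP[? ?] := spdA hz tT; lra.
Qed.

End pair.

Hypotheses (hul : admissible ul) (hur : admissible ur).
Hypotheses (vul : vel ul = sigma) (vur : vel ur = sigma).
Hypotheses (pl : pres gamma ul = pres gamma (prim rb sigma (eb gamma k)))
  (pr : pres gamma ur = pres gamma (prim rb sigma (eb gamma k))).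

Let pair_rho : cons_pair gamma sigma rb k ul ur (@rho R) (fun w => rho (flux gamma w)).
Proof. exact: cons_pair_rho. Qed.

Let pair_mom : cons_pair gamma sigma rb k ul ur (@mom R) (fun w => mom (flux gamma w)).
Proof. exact: cons_pair_mom. Qed.

Let pair_energy : cons_pair gamma sigma rb k ul ur (@energy R) (fun w => energy (flux gamma w)).
Proof. exact: cons_pair_energy. Qed.

Let pair_entropy : cons_pair gamma sigma rb k ul ur (entropy gamma) (entropy_flux gamma).
Proof. exact: cons_pair_entropy. Qed.

Let cont_pair f g : cons_pair gamma sigma rb k ul ur f g ->
  forall x : R, 0 < x -> {for x, continuous (fun y => f (W y))}.
Proof. by move=> [_ _ [P [_ dP]]] x x0; have [d1 _] := dP x x0; exact: cont_der d1. Qed.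

Lemma meas_sol f g : cons_pair gamma sigma rb k ul ur f g -> meas2 (fun t x => f (sol t x)).
Proof.
move=> fg; have cf := cont_pair fg.
have mline (c : R) : measurable_fun setT (fun p : R * R => c + sigma * p.1).
  by apply: measurable_funD => //; exact: measurable_funM.
have mA : meas2 (fun t x => f (W (- coordA t x))).
  have [|//] := @bmeas_fan _ (-1) (- xb) (-1 + xb * bw) bw l0 (- l1) zA01 (fun z => f (W (- z))).
  move=> z /andP[z1 z2]; apply: (@continuous_comp _ _ _ -%R (fun y => f (W y))); first exact: opp_continuous.
  by apply: cf; have ? := xb0; lra.
have mB : meas2 (fun t x => f (W (coordB t x))).
  have [|//] := @bmeas_fan _ xb 1 (1 - xb * bw) bw l0 l1 zB01 (fun z => f (W z)).
  by move=> z /andP[z1 z2]; apply: cf; exact: lt_le_trans z1.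
rewrite /meas2 (_ : (fun p : R * R => f (sol p.1 p.2)) = (fun p =>
  if p.2 < -3 + sigma * p.1 then f ul else
  if p.2 < 0 then f (W (- coordA p.1 p.2)) else
  if p.2 < 3 + sigma * p.1 then f (W (coordB p.1 p.2)) else f ur)); last first.
  by apply/funext => p; rewrite /sol; do 3 case: ifP => // _.
apply: measurable_fun_ifT => //; first exact: measurable_fun_ltr.
apply: measurable_fun_ifT => //; first exact: measurable_fun_ltr.
by apply: measurable_fun_ifT => //; exact: measurable_fun_ltr.
Qed.

Let T0in : 0 <= (0 : R) < T.
Proof. by apply/andP; split; [lra|exact: lifespan_gt0]. Qed.

Lemma sol_weak f g : cons_pair gamma sigma rb k ul ur f g ->
  weak_eq T (fun t x => f (sol t x)) (fun t x => g (sol t x)) (fun x => f (sol 0 x)).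
Proof.
move=> fg; apply: (weak_eq_ext _ _ _ (good_weak_eq (good_rep fg))) => [t x tT|t x tT|x];
  by rewrite sol_rep.
Qed.

Lemma sol_BVloc f g : cons_pair gamma sigma rb k ul ur f g -> BVloc T (fun t x => f (sol t x)).
Proof.
move=> fg; apply: (BVloc_ext _ (good_BVloc (good_rep fg))) => t x tT; by rewrite sol_rep.
Qed.

Lemma sol_entropy_weak_solution : entropy_weak_solution gamma T sol (sol 0).
Proof.
split.
- split; [exact: meas_sol pair_rho|exact: meas_sol pair_mom|exact: meas_sol pair_energy].
- split; [exact: (meas_section1 (meas_sol pair_rho))|exact: (meas_section1 (meas_sol pair_mom))|
    exact: (meas_section1 (meas_sol pair_energy))].
- split; [exact: sol_weak pair_rho|exact: sol_weak pair_mom|exact: sol_weak pair_energy].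
(* Entropy is conserved exactly: its weak equation, whose initial term vanishes as [a > 0], gives
   the inequality with equality. *)
move=> phi a b c d cphi a0 bT sphi phi0.
have := sol_weak pair_entropy cphi bT sphi.
rewrite [X in (_ + X)%E]integral0_eq ?adde0; first by move=> ->.
move=> x _; rewrite sphi ?mulr0// => -[/andP[+ _] _]; apply/negP; by rewrite -ltNge.
Qed.

Lemma sol_bounded : exists M : R, forall t x,
  `|rho (sol t x)| <= M /\ `|mom (sol t x)| <= M /\ `|energy (sol t x)| <= M.
Proof.
have bd f g : cons_pair gamma sigma rb k ul ur f g -> exists M : R, forall t x, `|f (sol t x)| <= M.
  move=> fg; have cf := cont_pair fg.
  have /compact_bounded[M [_ hM]] : compact ((fun y => f (W y)) @` `[xb, 1]).
    apply: continuous_compact; last exact: segment_compact.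
    apply: continuous_in_subspaceT => z; rewrite inE /= in_itv /= => /andP[z1 _].
    by apply: cf; exact: lt_le_trans z1.
  exists (`|M| + 1 + `|f ul| + `|f ur|) => t x.
  have [n1 n2 n3] : [/\ 0 <= `|M|, 0 <= `|f ul| & 0 <= `|f ur|] by split; exact: normr_ge0.
  case: (sol_cases t x) => [->|->|[z z1 ->]]; [lra|lra|].
  have : `|f (W z)| <= `|M| + 1; last by lra.
  by apply: hM; [rewrite (le_lt_trans (ler_norm M))// ltrDl|exists z => //=; rewrite in_itv].
have [M1 h1] := bd _ _ pair_rho; have [M2 h2] := bd _ _ pair_mom; have [M3 h3] := bd _ _ pair_energy.
exists (`|M1| + `|M2| + `|M3|) => t x.
have := h1 t x; have := h2 t x; have := h3 t x.
have := ler_norm M1; have := ler_norm M2; have := ler_norm M3.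
have := normr_ge0 M1; have := normr_ge0 M2; have := normr_ge0 M3 => *.
by split; [lra|split; lra].
Qed.

Lemma sol_admissible t x : admissible (sol t x).
Proof.
case: (sol_cases t x) => [->//|->//|[z /andP[z1 _] ->]].
have z0 : 0 < z := lt_le_trans xb0 z1.
split; first exact: wave_rho_gt0.
by rewrite eint_wave// mulr_gt0 ?exprn_gt0//; exact: eb_gt0.
Qed.

Let rint_itv (p q : R) : p <= q -> rint mu (\1_`[p, q]) = q - p.
Proof.
move=> pq; apply: EFin_inj; rewrite rint_EFin; last exact: integ_itv.
rewrite integral_indic//= setIT lebesgue_measure_itv /= lte_fin.
by case: ltP => [|qp]; rewrite ?EFinB//; congr EFin; lra.
Qed.

Section tails.
Variables (f g : state R -> R).
Hypothesis fg : cons_pair gamma sigma rb k ul ur f g.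
Variables (t h : R).
Hypotheses (tT : 0 <= t < T) (hh : -1/2 <= h <= 1/2).

Let brep : bmeas (rep f). Proof. by have [[]] := good_rep fg. Qed.

(** A half-line ending in the plateau is compared with a fixed interval that obeys the balance law;
    they differ only where the solution equals [W xb] or the integrand vanishes. The difference of
    two indicators is a signed interval, which treats both signs of [h] at once. *)
Let int_tail (A : set (measurableTypeR R)) (p q p1 q1 p2 q2 : R) : p <= q -> p1 <= q1 -> p2 <= q2 -> measurable A ->
  (forall x, \1_A x * f (sol t x) = \1_`[p, q] x * f (sol t x) +
     f (W xb) * (\1_`[p1, q1] x - \1_`[p2, q2] x)) ->
  balanced T p q (rep f) (rep g) ->
  (\int[mu]_(x in A) (f (sol t x))%:E)%E =
  (rint mu (fun x => \1_`[p, q] x * f (sol 0 x)) + t * (g (sol 0 p) - g (sol 0 q))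
    + f (W xb) * (q1 - p1 - (q2 - p2)))%:E.
Proof.
move=> pq pq1 pq2 mA E bal.
have i1 : integ mu (fun x => \1_`[p, q] x * f (sol t x)).
  rewrite (_ : (fun x => _) = fun x => \1_`[p, q] x * rep f t x); last by apply/funext => x; rewrite -sol_rep.
  exact: integ_bmeas brep (integ_itv p q).
have i2 : integ mu (fun x => \1_`[p1, q1] x - \1_`[p2, q2] x).
  have := integD (integ_itv p1 q1) (integZ (-1) (integ_itv p2 q2)).
  by apply: integ_ext => x; rewrite mulN1r.
have i3 : integ mu (fun x => \1_A x * f (sol t x)).
  by have := integD i1 (integZ (f (W xb)) i2); apply: integ_ext => x; rewrite E.
rewrite (int_set mA i3) (rintD_ext i1 (integZ (f (W xb)) i2)); last by move=> x; exact: E.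
rewrite (rintZ (f (W xb)) i2).
rewrite [X in f (W xb) * X](rintD_ext (integ_itv p1 q1) (integZ (-1) (integ_itv p2 q2))); last by move=> x; rewrite mulN1r.
rewrite rintZ; last exact: integ_itv.
rewrite !rint_itv// mulN1r; congr (_ + _)%:E.
have := bal t tT; rewrite -!sol_rep//.
have -> : rint mu (fun x => \1_`[p, q] x * rep f t x) = rint mu (fun x => \1_`[p, q] x * f (sol t x)).
  by apply: rint_ext => x; rewrite sol_rep.
by move=> ->; congr (_ + _); apply: rint_ext => x; rewrite sol_rep.
Qed.

Lemma int_left : f ul = 0 -> (\int[mu]_(x in [set x : R | (x < h)%R]) (f (sol t x))%:E)%E =
  (rint mu (fun x => \1_`[-5, 0] x * f (sol 0 x)) - t * (g (W xb) - g ul) + h * f (W xb))%:E.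
Proof.
move=> f0; case/andP: hh => h1 h2.
have -> : (\int[mu]_(x in [set x : R | (x < h)%R]) (f (sol t x))%:E =
    \int[mu]_(x in `]-oo, h]) (f (sol t x))%:E)%E.
  rewrite (_ : [set x | x < h] = `]-oo, h[%classic); last by apply/seteqP; split => x; rewrite /= in_itv.
  apply: integral_itv_bndo_bndc; apply/measurable_EFinP; apply: measurable_funTS.
  exact: (meas_section1 (meas_sol fg)).
(* -1 is a common left endpoint below [h] and 0: the difference of indicators lives between 0 and
   [h], within the plateau. To the left of -5 the solution is [ul], where [f] vanishes. *)
suff pw (x : R) : \1_`]-oo, h] x * f (sol t x) = \1_`[-5, 0] x * f (sol t x) +
    f (W xb) * (\1_`[-1, h] x - \1_`[-1, 0] x).
  have q0 : (-5 : R) <= 0 by lra.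
  have q1 : -1 <= h by lra.
  have q2 : (-1 : R) <= 0 by lra.
  rewrite (int_tail q0 q1 q2 (measurable_itv _) pw (balanced_left fg)).
  by rewrite (sol_left T0in) ?(sol_mid T0in); [congr EFin; ring|apply/andP; split; lra|lra].
have [xh|xh] := leP x h.
  rewrite (_ : \1_`]-oo, h] x = 1 :> R); last by rewrite indicE mem_set//= in_itv.
  have [x5|x5] := ltP x (-5).
    by rewrite sol_left// ?f0; [rewrite !notin_indic_itv; [ring|lra..]|lra].
  have [x1|x1] := ltP x (-1).
    rewrite (in_indic_itv (p := -5)); last by apply/andP; split; lra.
    by rewrite !notin_indic_itv; [ring|lra..].
  have [x0|x0] := leP x 0.
    by rewrite !in_indic_itv; [ring|apply/andP; split; lra..].
  rewrite (in_indic_itv (q := h)); last by apply/andP; split; lra.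
  rewrite !(notin_indic_itv (q := 0)); [|lra|lra].
  by rewrite sol_mid//; [ring|apply/andP; split; lra].
rewrite (_ : \1_`]-oo, h] x = 0 :> R); last first.
  by rewrite indicE memNset//= in_itv /=; apply/negP; rewrite -ltNge.
rewrite (notin_indic_itv (q := h)); last by lra.
have [x0|x0] := leP x 0.
  rewrite !in_indic_itv; [|apply/andP; split; lra..].
  by rewrite sol_mid//; [ring|apply/andP; split; lra].
by rewrite !notin_indic_itv; [ring|lra..].
Qed.

Lemma int_right : f ur = 0 -> (\int[mu]_(x in [set x : R | (h < x)%R]) (f (sol t x))%:E)%E =
  (rint mu (fun x => \1_`[0, 5] x * f (sol 0 x)) + t * (g (W xb) - g ur) - h * f (W xb))%:E.
Proof.
move=> f0; case/andP: hh => h1 h2.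
have -> : (\int[mu]_(x in [set x : R | (h < x)%R]) (f (sol t x))%:E =
    \int[mu]_(x in `[h, +oo[) (f (sol t x))%:E)%E.
  rewrite (_ : [set x | h < x] = `]h, +oo[%classic); last by apply/seteqP; split => x; rewrite /= in_itv /= andbT.
  apply: integral_itv_obnd_cbnd; apply/measurable_EFinP; apply: measurable_funTS.
  exact: (meas_section1 (meas_sol fg)).
(* Mirror image, with 1 as common right endpoint and [f ur = 0] beyond 5. *)
suff pw (x : R) : \1_`[h, +oo[ x * f (sol t x) = \1_`[0, 5] x * f (sol t x) +
    f (W xb) * (\1_`[h, 1] x - \1_`[0, 1] x).
  have q0 : (0 : R) <= 5 by lra.
  have q1 : h <= 1 by lra.
  have q2 : (0 : R) <= 1 by lra.
  rewrite (int_tail q0 q1 q2 (measurable_itv _) pw (balanced_right fg)).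
  have -> : sol 0 5 = ur by apply: (sol_right T0in); lra.
  have -> : sol 0 0 = W xb by apply: (sol_mid T0in); apply/andP; split; lra.
  by congr EFin; ring.
have [xh|xh] := leP h x.
  rewrite (_ : \1_`[h, +oo[ x = 1 :> R); last by rewrite indicE mem_set//= in_itv /= xh.
  have [x5|x5] := ltP 5 x.
    by rewrite sol_right// ?f0; [rewrite !notin_indic_itv; [ring|lra..]|lra].
  have [x1|x1] := ltP 1 x.
    rewrite (in_indic_itv (q := 5)); last by apply/andP; split; lra.
    by rewrite !notin_indic_itv; [ring|lra..].
  have [x0|x0] := leP 0 x.
    by rewrite !in_indic_itv; [ring|apply/andP; split; lra..].
  rewrite (in_indic_itv (p := h)); last by apply/andP; split; lra.
  rewrite !(notin_indic_itv (p := 0)); [|lra|lra].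
  by rewrite sol_mid//; [ring|apply/andP; split; lra].
rewrite (_ : \1_`[h, +oo[ x = 0 :> R); last first.
  by rewrite indicE memNset//= in_itv /= andbT; apply/negP; rewrite -ltNge.
rewrite (notin_indic_itv (p := h)); last by lra.
have [x0|x0] := leP 0 x.
  rewrite !in_indic_itv; [|apply/andP; split; lra..].
  by rewrite sol_mid//; [ring|apply/andP; split; lra].
by rewrite !notin_indic_itv; [ring|lra..].
Qed.

End tails.

Lemma sol_Ea (a t h : R) : 0 <= t < T -> -1/2 <= h <= 1/2 ->
  Ea gamma a ul ur (sol t) h =
  (rint mu (fun x => \1_`[-5, 0] x * rel_entropy gamma (sol 0 x) ul)
   + a * rint mu (fun x => \1_`[0, 5] x * rel_entropy gamma (sol 0 x) ur)
   + h * relgap gamma ul ur a (W xb) + t * growth gamma ul ur a (W xb))%:E.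
Proof.
move=> tT hh.
have pairl := cons_pair_rel g1 rb0 k0 hul hur vul vur pl pr hul.
have pairr := cons_pair_rel g1 rb0 k0 hul hur vul vur pl pr hur.
rewrite /Ea (int_left pairl tT hh (rel_entropy_self gamma hul)).
rewrite (int_right pairr tT hh (rel_entropy_self gamma hur)).
by rewrite -EFinM -EFinD /relgap /growth; congr EFin; ring.
Qed.

End solution.

(** * The contradiction with contraction *)

Lemma admissible_convex (R : realType) (w1 w2 : state R) (l : R) :
  admissible w1 -> admissible w2 -> 0 <= l <= 1 ->
  admissible (sadd (sscale l w1) (sscale (1 - l) w2)).
Proof.
move=> [r1 e1] [r2 e2] /andP[l0 l1].
rewrite (prim_state (lt0r_neq0 r1)) (prim_state (lt0r_neq0 r2)).
move: (rho w1) (vel w1) (eint w1) (rho w2) (vel w2) (eint w2) r1 e1 r2 e2 => p1 v1 c1 p2 v2 c2 r1 e1 r2 e2.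
have lp1 : 0 <= l * p1 by rewrite mulr_ge0// ltW.
have lp2 : 0 <= (1 - l) * p2 by rewrite mulr_ge0 ?subr_ge0// ltW.
have sp : 0 < l * p1 + (1 - l) * p2.
  have [->|ln] := eqVneq l 0; first by rewrite mul0r add0r subr0 mul1r.
  by rewrite ltr_pwDl// mulr_gt0// lt_neqAle eq_sym ln.
have se : 0 < l * p1 * c1 + (1 - l) * p2 * c2.
  have [->|ln] := eqVneq l 0; first by rewrite !mul0r add0r subr0 mul1r mulr_gt0.
  by rewrite ltr_pwDl ?mulr_ge0 ?subr_ge0 ?(ltW r2) ?(ltW e2)// !mulr_gt0// lt_neqAle eq_sym ln.
split; first by rewrite /sadd /sscale /mkstate /rho.
(* The internal energy of a mixture is the mass-weighted mean plus the kinetic energy of the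
   relative motion, which is nonnegative. *)
have -> : eint (sadd (sscale l (prim p1 v1 c1)) (sscale (1 - l) (prim p2 v2 c2))) =
   (l * p1 * c1 + (1 - l) * p2 * c2) / (l * p1 + (1 - l) * p2) +
   l * p1 * ((1 - l) * p2) * (v1 - v2) ^+ 2 / (2 * (l * p1 + (1 - l) * p2) ^+ 2).
  rewrite /eint /sadd /sscale /prim /mkstate /rho /mom /energy /=.
  by field; rewrite gt_eqF.
rewrite ltr_pwDl ?divr_gt0// divr_ge0//; first by rewrite mulr_ge0 ?sqr_ge0// mulr_ge0.
by rewrite mulr_ge0// sqr_ge0.
Qed.

(** Supplies times outside the exceptional set of the monotonicity of [E_a]. *)
Lemma negligible_itv (R : realType) (N : set R) (p q : R) :
  (@lebesgue_measure R).-negligible N -> p < q -> exists2 x : R, p < x < q & ~ N x.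
Proof.
move=> [A [mA A0 NA]] pq; apply: contrapT => h.
have sub : `]p, q[%classic `<=` A.
  move=> x; rewrite /= in_itv /= => xpq; apply: NA; apply: contrapT => Nx.
  by apply: h; exists x.
have : (@lebesgue_measure R `]p, q[%classic <= @lebesgue_measure R A)%E.
  by apply: le_measure => //; rewrite inE.
by rewrite A0 lebesgue_measure_itv /= lte_fin pq -EFinB lee_fin; lra.
Qed.

Lemma not_a_contraction (R : realType) (gamma a sigma rb k xb : R) (ul ur : state R) :
  1 < gamma -> 0 < rb -> k != 0 -> 0 < xb < 1 -> admissible ul -> admissible ur ->
  vel ul = sigma -> vel ur = sigma ->
  pres gamma ul = pres gamma (prim rb sigma (eb gamma k)) ->
  pres gamma ur = pres gamma (prim rb sigma (eb gamma k)) ->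
  relgap gamma ul ur a (wave gamma sigma rb k xb) = 0 ->
  0 < growth gamma ul ur a (wave gamma sigma rb k xb) ->
  ~ a_contraction gamma a ul ur sigma.
Proof.
move=> g1 rb0 k0 xb01 hl hr vl vr pl pr G0 D0.
pose T := lifespan gamma sigma k; have T0 : 0 < T := lifespan_gt0 gamma sigma k.
pose u := sol gamma sigma rb k xb ul ur.
have [M hM] : exists M : R, forall t x, `|rho (u t x)| <= M /\ `|mom (u t x)| <= M /\ `|energy (u t x)| <= M.
  exact: sol_bounded.
(* All admissible states in a box containing the values of the solution; convexity of admissibility
   makes the set convex. *)
pose UK : set (state R) := [set w | admissible w /\ (`|rho w| <= M /\ `|mom w| <= M /\ `|energy w| <= M)].
have hUK : bounded_convex_states UK.
  split; [by move=> w []|by exists M => w []|].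
  move=> w1 w2 l [a1 [b1 [c1 d1]]] [a2 [b2 [c2 d2]]] l01; split; first exact: admissible_convex.
  have cvx (x y : R) : `|x| <= M -> `|y| <= M -> `|l * x + (1 - l) * y| <= M.
    case/andP: l01 => l0 l1 xM yM; apply: le_trans (ler_normD _ _) _.
    rewrite !normrM (ger0_norm l0) (ger0_norm (_ : 0 <= 1 - l)) ?subr_ge0//.
    rewrite [leRHS](_ : _ = l * M + (1 - l) * M); last by ring.
    by apply: lerD; apply: ler_wpM2l; rewrite ?subr_ge0.
  by split; [exact: cvx|split; exact: cvx].
have uUK t x : UK (u t x) by split; [exact: sol_admissible|exact: hM].
move=> /(_ UK hUK)[CK /(_ T u (u 0) T0)].
have EaE (t h : R) := @sol_Ea R gamma sigma rb k xb ul ur g1 rb0 k0 xb01 hl hr vl vr pl pr a t h.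
have B1 : BVloc T (fun t x => rho (u t x)).
  have pf : cons_pair gamma sigma rb k ul ur (@rho R) (fun w => rho (flux gamma w)) by exact: cons_pair_rho.
  exact: (sol_BVloc xb01 pf).
have B2 : BVloc T (fun t x => mom (u t x)).
  have pf : cons_pair gamma sigma rb k ul ur (@mom R) (fun w => mom (flux gamma w)) by exact: cons_pair_mom.
  exact: (sol_BVloc xb01 pf).
have B3 : BVloc T (fun t x => energy (u t x)).
  have pf : cons_pair gamma sigma rb k ul ur (@energy R) (fun w => energy (flux gamma w)) by exact: cons_pair_energy.
  exact: (sol_BVloc xb01 pf).
have ws : entropy_weak_solution gamma T u (u 0) by exact: sol_entropy_weak_solution.
case=> //.
- by rewrite EaE ?ltry//; apply/andP; split => //; lra.
move=> h [h00 [L hL] [N [negN decr]] _ _].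
(* Before this time [|h t| <= L * t <= 1/2], so the shift is still in the plateau; [|L| + 1] is
   positive whatever [L] is. *)
pose dl := Num.min T (2 * (`|L| + 1))^-1.
have L0 : 0 < `|L| + 1 by rewrite ltr_wpDl.
have dl0 : 0 < dl by rewrite lt_min T0 invr_gt0 mulr_gt0.
have dlT : dl <= T by rewrite ge_min lexx.
have dlL : dl <= (2 * (`|L| + 1))^-1 by rewrite ge_min lexx orbT.
have hsmall (t : R) : 0 <= t < dl -> -1/2 <= h t <= 1/2.
  move=> /andP[t0 tdl].
  have hLt : `|h t| <= L * t.
    have := hL 0 t; rewrite h00 !subr0 (ger0_norm t0); apply; apply/andP; split=> //.
    exact: lt_le_trans dlT.
  have : `|h t| <= 1 / 2.
    apply: (le_trans hLt); apply: (@le_trans _ _ ((`|L| + 1) * (2 * (`|L| + 1))^-1)).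
      have LL : L <= `|L| + 1 by rewrite (le_trans (ler_norm L))// lerDl.
      have tt : t <= (2 * (`|L| + 1))^-1 by exact: le_trans (ltW tdl) dlL.
      apply: (@le_trans _ _ ((`|L| + 1) * t)); first by rewrite ler_wpM2r.
      by rewrite ler_wpM2l// ltW.
    by rewrite le_eqVlt; apply/orP; left; apply/eqP; field; rewrite gt_eqF.
  by rewrite ler_norml => /andP[? ?]; apply/andP; split; lra.
have d1 : 0 < dl / 2 by lra.
have d2 : dl / 2 < dl by lra.
(* Good times from the two halves of [(0, dl)] are automatically ordered, [s < t]. *)
have [s /andP[s0 s1] Ns] := negligible_itv negN d1.
have [t /andP[t0 t1] Nt] := negligible_itv negN d2.
have sT : 0 <= s < T by apply/andP; split; lra.
have tT : 0 <= t < T by apply/andP; split; lra.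
have hs : -1/2 <= h s <= 1/2 by apply: hsmall; apply/andP; split; lra.
have ht : -1/2 <= h t <= 1/2 by apply: hsmall; apply/andP; split; lra.
have := decr s t s0 ltac:(lra) ltac:(lra) Ns Nt.
(* The zero of [relgap] removes [h s] and [h t]; what is left of the inequality is [t <= s]. *)
rewrite (EaE _ _ sT hs) (EaE _ _ tT ht) G0 !mulr0 !addr0 lee_fin lerD2l ler_pM2r//.
by rewrite leNgt => /negP; apply; lra.
Qed.

Theorem theorem6p2 (R : realType) (gamma : R) (ul ur : state R) (sigma : R) :
  1 < gamma -> contact2 gamma ul ur sigma ->
  (eint ur < eint ul ->
     forall a : R, (0 < a < eint ur / eint ul) \/ 1 < a ->
       ~ a_contraction gamma a ul ur sigma) /\
  (eint ul < eint ur ->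
     forall a : R, (0 < a < 1) \/ eint ur / eint ul < a ->
       ~ a_contraction gamma a ul ur sigma).
Proof.
move=> g1 [hl hr _ [vl vr] p].
have el : 0 < eint ul by case: hl.
have er : 0 < eint ur by case: hr.
(* Each of the four ranges consists of positive numbers different from [e_r / e_l]. *)
have key (a : R) : 0 < a -> a != eint ur / eint ul -> eint ul != eint ur ->
    ~ a_contraction gamma a ul ur sigma.
  move=> a0 an ne.
  have an' : a / eint ur != (eint ul)^-1.
    by apply: contra_neq an => h; rewrite -[a](divfK (lt0r_neq0 er)) h mulrC.
  have [rb [k [x [[rb0 k0] x01 pl G0 D0]]]] := exists_wave g1 hl hr vl vr p ne a0 an'.
  exact: (not_a_contraction g1 rb0 k0 x01 hl hr vl vr pl (etrans (esym p) pl) G0 D0).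
have q0 : 0 < eint ur / eint ul by rewrite divr_gt0.
split=> lt_e a [h|h].
- by case/andP: h => a0 aq; apply: key => //; [rewrite lt_eqF|rewrite gt_eqF].
- apply: key; [exact: lt_trans h| |by rewrite gt_eqF].
  by rewrite gt_eqF// (lt_trans _ h)// ltr_pdivrMr// mul1r.
- case/andP: h => a0 a1; apply: key => //; last by rewrite lt_eqF.
  by rewrite lt_eqF// (lt_trans a1)// ltr_pdivlMr// mul1r.
- by apply: key; [exact: lt_trans h|rewrite gt_eqF|rewrite lt_eqF].
Qed.
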